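(* The complex surfaces $\mathbb{P}(\mathbb{C}^3)$ and $\mathbb{P}(\mathbb{C}^2\oplus\mathbb{C}^\sigma)$, with their natural $C_2$-actions, are not equivariantly cobordant (as complex $C_2$-manifolds).
   Context: $C_2$ is the group of order two, $\mathbb{C}$ is its trivial complex representation and $\mathbb{C}^\sigma$ its complex sign representation. For a complex representation $V$, $\mathbb{P}(V)$ is the projective space of complex lines in $V$ with the induced $C_2$-action; so $\mathbb{P}(\mathbb{C}^3)$ has trivial action. Both are complex $C_2$-manifolds (closed $C_2$-manifolds whose tangent bundle has a given $C_2$-equivariant complex structure). Equivariant cobordism is cobordism of (stably almost) complex $C_2$-manifolds: $M$ and $N$ are cobordant if there is a compact $C_2$-manifold $W$ with $\partial W\cong M\sqcup N$, with a $C_2$-equivariant complex structure on $\tau_W\oplus\mathbb{R}^k$ for some trivial summand $\mathbb{R}^k$, restricting on the boundary (up to the usual stabilization) to the given structure on $M$ and the opposite of the given structure on $N$. *)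

(* Defs.v *)
From HB Require Import structures.
From mathcomp Require Import all_boot all_order all_algebra.
From mathcomp Require Import all_classical all_reals all_analysis.
From mathcomp Require Import complex ring.

Set Implicit Arguments.
Unset Strict Implicit.
Unset Printing Implicit Defensive.

Import Order.TTheory GRing.Theory Num.Theory.
Import numFieldNormedType.Exports.

Local Open Scope classical_set_scope.
Local Open Scope ring_scope.

Section Smoothness.
Context {R : realType}.

(* [O] is meant to be open.  In C^(k+1) it is enough to ask for the directional
   derivatives to exist and to be C^k, in every (constant) direction. *)
Fixpoint Ck {V W : normedModType R} (O : set V) (k : nat) (f : V -> W) : Prop :=
  (forall x, O x -> {for x, continuous f}) /\
  (if k is k'.+1 then
     forall v, (forall x, O x -> derivable f x v) /\ Ck O k' ('D_v f)
   else True).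

(* Smoothness on an arbitrary subset: local extendability to a C^oo function on
   an open set. *)
Definition smooth_on {V W : normedModType R} (A : set V) (f : V -> W) : Prop :=
  forall x, A x -> exists O g, [/\ open O, O x,
    (forall k, Ck O k g) & (forall y, A y -> O y -> f y = g y)].

(* Matrices act on row vectors from the right.  [D] is unique when [A] is
   relatively open in R^m or in a half-space, the only cases used below. *)
Definition diff_within m n (A : set 'rV[R]_m) (f : 'rV[R]_m -> 'rV[R]_n)
    (x : 'rV[R]_m) (D : 'M[R]_(m, n)) : Prop :=
  forall e : R, 0 < e -> \forall y \near within A (nbhs x),
    `|f y - f x - (y - x) *m D| <= e * `|y - x|.

End Smoothness.

Section Manifolds.
Context {R : realType}.

(* [param] is the inverse of [coord]; the values of [coord] outside [dom], and
   of [param] outside of the image of [dom], are irrelevant. *)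
Record chart (T : topologicalType) n (H : set 'rV[R]_n) := Chart {
  dom : set T ;
  coord :> T -> 'rV[R]_n ;
  param : 'rV[R]_n -> T ;
  dom_open : open dom ;
  coord_image : exists2 O, open O & coord @` dom = O `&` H ;
  coordK : forall p, dom p -> param (coord p) = p ;
  coord_continuous_on : {within dom, continuous coord} ;
  param_continuous_on : {within coord @` dom, continuous param} }.

(* Compact smooth n-manifolds modelled on H: without boundary if H is the whole
   space, with boundary if H is a half-space.  Second countability follows from
   compactness. *)
Record compact_mfd n (H : set 'rV[R]_n) := CompactMfd {
  carrier :> topologicalType ;
  chart_index : Type ;
  chart_at : chart_index -> chart carrier H ;
  mfd_hausdorff : hausdorff_space carrier ;
  mfd_compact : compact [set: carrier] ;
  mfd_cover : forall p, exists i, dom (chart_at i) p ;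
  mfd_transition : forall i j,
    smooth_on (chart_at i @` (dom (chart_at i) `&` dom (chart_at j)))
              (chart_at j \o param (chart_at i)) }.

Arguments chart_at {n H} c _.

Section Maps.
Context {m n : nat} {H : set 'rV[R]_m} {K : set 'rV[R]_n}.
Context {M : compact_mfd H} {N : compact_mfd K}.
Implicit Types (i : chart_index M) (j : chart_index N).

Definition local_dom (f : M -> N) i j : set 'rV[R]_m :=
  chart_at M i @` (dom (chart_at M i) `&` f @^-1` dom (chart_at N j)).

Definition local_expr (f : M -> N) i j : 'rV[R]_m -> 'rV[R]_n :=
  chart_at N j \o f \o param (chart_at M i).

Definition smooth_map (f : M -> N) : Prop :=
  continuous f /\ forall i j, smooth_on (local_dom f i j) (local_expr f i j).

(* D is the matrix of the tangent map T_p f in the charts i at p and j at f p. *)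
Definition tangent_map (f : M -> N) i j (p : M) (D : 'M[R]_(m, n)) : Prop :=
  [/\ dom (chart_at M i) p, dom (chart_at N j) (f p)
    & diff_within (local_dom f i j) (local_expr f i j) (chart_at M i p) D].

(* M being compact, an injective immersion is a diffeomorphism onto its image. *)
Definition embedding (f : M -> N) : Prop :=
  [/\ injective f, smooth_map f
    & forall i j p D, tangent_map f i j p D -> row_free D].

End Maps.

(* A smooth action of C_2, given by the action of its generator. *)
Record C2_mfd n (H : set 'rV[R]_n) := C2Mfd {
  C2_mfd_sort :> compact_mfd H ;
  flip : C2_mfd_sort -> C2_mfd_sort ;
  flip_smooth : smooth_map flip ;
  flipK : involutive flip }.

(* id_(R^k) (+) D *)
Definition stab {m n} k (D : 'M[R]_(m, n)) : 'M[R]_(k + m, k + n) :=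
  block_mx 1%:M 0 0 D.

(* A C_2-equivariant complex structure on the vector bundle R^k (+) TM, with
   trivial action on R^k.  J i p is its matrix in the chart i at p; the trivial
   summand occupies the first k coordinates. *)
Record equivariant_complex_structure n (H : set 'rV[R]_n) (M : C2_mfd H) k
    (J : chart_index M -> M -> 'M[R]_(k + n)) : Prop := {
  ecs_smooth : forall i,
    smooth_on (chart_at M i @` dom (chart_at M i))
              (J i \o param (chart_at M i)) ;
  ecs_sqr : forall i p, dom (chart_at M i) p -> J i p *m J i p = - 1%:M ;
  ecs_compat : forall i j p D, tangent_map (@id M) i j p D ->
    J i p *m stab k D = stab k D *m J j p ;
  ecs_flip : forall i j p D, tangent_map (@flip n H M) i j p D ->
    J i p *m stab k D = stab k D *m J j (flip p) }.

(* Closed complex C_2-manifolds of real dimension d. *)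
Record complex_C2_mfd d := ComplexC2Mfd {
  complex_C2_mfd_sort :> C2_mfd [set: 'rV[R]_d] ;
  almost_complex : chart_index complex_C2_mfd_sort -> complex_C2_mfd_sort ->
                   'M[R]_d ;
  almost_complexP :
    @equivariant_complex_structure d _ complex_C2_mfd_sort 0 almost_complex }.

Definition half_space d : set 'rV[R]_d.+1 := [set x | 0 <= x 0 0].
Arguments half_space : clear implicits.

Definition boundary d (W : C2_mfd (half_space d)) : set W :=
  [set w | exists2 i, dom (chart_at W i) w & chart_at W i w 0 0 = 0].
Arguments boundary {d} W _.

Definition outward d (nu : 'rV[R]_d.+1) : Prop := nu 0 0 < 0.
Definition inward d (nu : 'rV[R]_d.+1) : Prop := 0 < nu 0 0.
Arguments outward : clear implicits.
Arguments inward : clear implicits.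

(* Multiplication by the imaginary unit on R^(n+n) = C^n, where (x, y) stands
   for x + 'i y. *)
Definition std_complex n : 'M[R]_(n + n) := block_mx 0 1%:M (- 1%:M) 0.

(* Along iota : M -> boundary W there is a field nu of vectors of TW transverse
   to the boundary, on the side prescribed by [side], such that under
     R^(1+2l) (+) iota^*TW = R (+) C^l (+) R nu (+) TM
   the structure JW becomes that of TM, plus that of C^l, plus the one of
   R nu (+) R = C sending nu to the generator of R.  (Smoothness and
   equivariance of nu follow from those of JW.) *)
Definition restricts_to (side : forall d, 'rV[R]_d.+1 -> Prop)
    d (W : C2_mfd (half_space d)) l
    (JW : chart_index W -> W -> 'M[R]_((1 + (l + l)) + d.+1))
    (M : complex_C2_mfd d) (iota : M -> W) : Prop :=
  forall i j p D, tangent_map iota i j p D ->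
  exists2 nu : 'rV[R]_d.+1, side d nu &
    forall (a b : R) (z : 'rV[R]_(l + l)) (v : 'rV[R]_d),
      row_mx (row_mx a%:M z) (b *: nu + v *m D) *m JW j (iota p) =
      row_mx (row_mx b%:M (z *m std_complex l))
             (- a *: nu + (v *m almost_complex i p) *m D).

(* Using the outward normal on M and the inward normal on N is what makes the
   structure induced on N the opposite of the given one: it changes the complex
   structure of the stabilizing summand R nu (+) R = C, nu outward, into its
   conjugate. *)
Definition cobordant d (M N : complex_C2_mfd d) : Prop :=
  exists (W : C2_mfd (half_space d)) (l : nat)
    (JW : chart_index W -> W -> 'M[R]_((1 + (l + l)) + d.+1))
    (iM : M -> W) (iN : N -> W),
  [/\ equivariant_complex_structure JW,
      [/\ embedding iM, embedding iN,
          range iM `&` range iN = set0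
        & range iM `|` range iN = boundary W],
      (forall p, iM (flip p) = flip (iM p)),
      (forall p, iN (flip p) = flip (iN p))
    & restricts_to outward JW iM /\ restricts_to inward JW iN].

End Manifolds.

Section SmoothCalculus.
Context {R : realType} {V : normedModType R} (O : set V).
Hypothesis oO : open O.

Lemma Ck_continuous (W : normedModType R) k (f : V -> W) :
  Ck O k f -> forall x, O x -> {for x, continuous f}.
Proof. by case: k => [|k] []. Qed.

Lemma CkW (W : normedModType R) k (f : V -> W) : Ck O k.+1 f -> Ck O k f.
Proof.
elim: k f => [|k IH] f [fc fd]; first by split.
by split=> // v; have [fv Dv] := fd v; split=> //; exact: IH.
Qed.

Lemma Ck_ext (W : normedModType R) k (f g : V -> W) :
  (forall x, O x -> f x = g x) -> Ck O k f -> Ck O k g.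
Proof.
have near_eq (h h' : V -> W) x : (forall y, O y -> h y = h' y) -> O x ->
    \forall y \near x, h y = h' y.
  by move=> hh' Ox; apply: filterS hh' _; exact: open_nbhs_nbhs.
elim: k f g => [|k IH] f g fg [fc fd]; split => //.
- move=> x Ox; rewrite /prop_for /continuous_at -fg//.
  by apply: cvg_trans (fc x Ox); apply: near_eq_cvg; exact: near_eq.
- move=> x Ox; rewrite /prop_for /continuous_at -fg//.
  by apply: cvg_trans (fc x Ox); apply: near_eq_cvg; exact: near_eq.
move=> v; have [fv Dv] := fd v; split=> [x Ox|].
  by apply: (near_eq_derivable _ (fv x Ox)); exact: near_eq.
by apply: IH Dv => x Ox; apply: near_eq_derive; exact: near_eq.
Qed.

Lemma Ck_cst (W : normedModType R) k (a : W) : Ck O k (fun=> a).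
Proof.
elim: k a => [|k IH] a; split=> //=; try by move=> x _; exact: cst_continuous.
move=> v; split=> [x _|]; first exact: derivable_cst.
by apply: (@Ck_ext _ k (fun=> 0)) => // x _; rewrite (derive_cst a).
Qed.

Lemma CkD (W : normedModType R) k (f g : V -> W) :
  Ck O k f -> Ck O k g -> Ck O k (fun x => f x + g x).
Proof.
elim: k f g => [|k IH] f g [fc fd] [gc gd]; split=> //=;
  try by move=> x Ox; apply: (@continuousD _ _ _ f g); [exact: fc|exact: gc].
move=> v; have [fv Dfv] := fd v; have [gv Dgv] := gd v; split.
  by move=> x Ox; apply: (derivableD (fv x Ox) (gv x Ox)).
apply: (Ck_ext _ (IH _ _ Dfv Dgv)) => x Ox.
by rewrite -(deriveD (fv x Ox) (gv x Ox)).
Qed.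

Lemma Ck_scalel (W : normedModType R) k (f : V -> R) (w : W) :
  Ck O k f -> Ck O k (fun x => f x *: w).
Proof.
elim: k f => [|k IH] f [fc fd]; split=> //=;
  try by move=> x Ox; apply: (@continuousZr_tmp _ _ _ f w); exact: fc.
have cv v x : derivable f x v ->
    h^-1 *: (((fun x => f x *: w) \o shift x) (h *: v) - f x *: w)
      @[h --> 0^'] --> 'D_v f x *: w.
  move=> fx; rewrite [X in X @ _](_ : _ =
     (fun h => (h^-1 *: ((f \o shift x) (h *: v) - f x)) *: w)).
    by apply: cvgZr_tmp.
  by apply/funext => h /=; rewrite -scalerBl scalerA.
move=> v; have [fv Dfv] := fd v; split.
  by move=> x Ox; apply/cvg_ex; eexists; apply: cv; exact: fv.
apply: (Ck_ext _ (IH _ Dfv)) => x Ox.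
by rewrite -(cvg_lim _ (cv _ _ (fv x Ox))).
Qed.

Lemma CkM k (f g : V -> R) :
  Ck O k f -> Ck O k g -> Ck O k (fun x => f x * g x).
Proof.
elim: k f g => [|k IH] f g fk gk;
  (split=> [x Ox|//=]; first by apply: continuousM;
     [exact: Ck_continuous fk _ Ox | exact: Ck_continuous gk _ Ox]).
move=> v; have [_ /(_ v)[fv Dfv]] := fk; have [_ /(_ v)[gv Dgv]] := gk; split.
  by move=> x Ox; apply: (derivableM (fv x Ox) (gv x Ox)).
apply: (Ck_ext _ (CkD (IH _ _ (CkW fk) Dgv) (IH _ _ (CkW gk) Dfv))) => x Ox.
by rewrite -[LHS](deriveM (fv x Ox) (gv x Ox)).
Qed.

Lemma CkN k (f : V -> R) : Ck O k f -> Ck O k (fun x => - f x).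
Proof.
move=> fk; apply: (Ck_ext _ (CkM (Ck_cst k (-1 : R)) fk)) => x Ox.
by rewrite mulN1r.
Qed.

Lemma CkV k (f : V -> R) : (forall x, O x -> f x != 0) ->
  Ck O k f -> Ck O k (fun x => (f x)^-1).
Proof.
move=> f0; elim: k => [|k IH] fk;
  (split=> [x Ox|//=]; first by apply: continuousV; [exact: f0|
     exact: Ck_continuous fk _ Ox]).
move=> v; have [_ /(_ v)[fv Dfv]] := fk; split.
  by move=> x Ox; apply: derivableV; [exact: f0|exact: fv].
have iv := IH (CkW fk).
apply: (Ck_ext _ (CkM (CkN (CkM iv iv)) Dfv)) => x Ox.
rewrite [RHS]deriveV; [|exact: f0|exact: fv].
by rewrite -invfM -expr2.
Qed.

Lemma Ck_row k n (f : V -> 'rV[R]_n) :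
  (forall j, Ck O k (fun x => f x 0 j)) -> Ck O k f.
Proof.
move=> fk; have sumk (s : seq 'I_n) :
    Ck O k (fun x => \sum_(j <- s) f x 0 j *: delta_mx 0 j : 'rV_n).
  elim: s => [|j s IH].
    by apply: (Ck_ext _ (Ck_cst k 0)) => x _; rewrite big_nil.
  apply: (Ck_ext _ (CkD (Ck_scalel _ (fk j)) IH)) => x _.
  by rewrite big_cons.
by apply: (Ck_ext _ (sumk _)) => x _; rewrite [RHS]row_sum_delta.
Qed.

End SmoothCalculus.

Lemma is_derive_coord (R : realType) n (x v : 'rV[R]_n) j :
  is_derive x v (fun x : 'rV[R]_n => x 0 j : R) (v 0 j).
Proof.
have slin : linear (fun y : 'rV[R]_n => y 0 j : R).
  by move=> a y z; rewrite !mxE.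
pose sL := GRing.isLinear.Build _ _ _ _ _ slin.
pose f : {linear 'rV[R]_n -> R} := HB.pack (fun y : 'rV[R]_n => y 0 j : R) sL.
have cf : continuous f by exact: coord_continuous.
apply: DeriveDef; first by apply: diff_derivable; exact: differentiable_coord.
rewrite deriveE; last exact: differentiable_coord.
by have /(congr1 (fun g => g v)) := diff_lin x cf.
Qed.

Lemma Ck_coord (R : realType) n (O : set 'rV[R]_n) k j : open O ->
  Ck O k (fun x => x 0 j : R).
Proof.
move=> oO; case: k => [|k]; split=> //=;
  try by move=> x _; exact: coord_continuous.
move=> v; split=> [x _|]; first by case: (is_derive_coord x v j).
apply: (Ck_ext oO _ (Ck_cst oO k (v 0 j))) => x _.
by case: (is_derive_coord x v j).
Qed.


Lemma is_derive_cvg (R : realType) (V W : normedModType R) (f : V -> W)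
    (x v : V) (d : W) :
  h^-1 *: (f (h *: v + x) - f x) @[h --> 0^'] --> d -> is_derive x v f d.
Proof.
move=> fd; apply: DeriveDef; first by apply/cvg_ex; exists d.
exact: cvg_lim fd.
Qed.

Lemma is_derive_coord_of (R : realType) (V : normedModType R) n
    (f : V -> 'rV[R]_n) (x v : V) (d : 'rV[R]_n) j :
  is_derive x v f d -> is_derive x v (fun y => f y 0 j) (d 0 j).
Proof.
move=> [fx fd]; apply: is_derive_cvg.
have fc : h^-1 *: (f (h *: v + x) - f x) @[h --> 0^'] --> d.
  by rewrite -fd; exact: fx.
rewrite (_ : (fun h => _) = (fun h => (h^-1 *: (f (h *: v + x) - f x)) 0 j)).
  apply: (cvg_comp _ (fun M : 'rV[R]_n => M 0 j) fc).
  exact: coord_continuous.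
by apply/funext => h; rewrite !mxE.
Qed.

Lemma diff_within_derive (R : realType) m n (U : set 'rV[R]_m)
    (f : 'rV[R]_m -> 'rV[R]_n) x (D : 'M[R]_(m, n)) (v : 'rV[R]_m) :
  open U -> U x -> diff_within U f x D -> is_derive x v f (v *m D).
Proof.
move=> oU Ux dD; have [->|v0] := eqVneq v 0.
  by rewrite mul0mx; exact: is_derive0.
apply: is_derive_cvg; apply/cvgrPdist_lt => e e0.
have nv : 0 < `|v| by rewrite normr_gt0.
have e'0 : 0 < e / 2 / `|v| by rewrite !divr_gt0.
have H : \forall y \near x,
    `|f y - f x - (y - x) *m D| <= e / 2 / `|v| * `|y - x|.
  have nU := open_nbhs_nbhs (conj oU Ux).
  have dD' : nbhs x (fun y => U y ->
    `|f y - f x - (y - x) *m D| <= e / 2 / `|v| * `|y - x|) := dD _ e'0.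
  by near=> y; apply: (near dD' y) => //; apply: (near nU y).
have cx : h *: v + x @[h --> (0 : R)^'] --> x.
  rewrite -[X in _ --> X]add0r -(scale0r v); apply: cvgD; last exact: cvg_cst.
  by apply: cvgZr_tmp; apply: cvg_within.
have := cx _ H; rewrite /nbhs /= => H'.
near=> t.
have t0 : t != 0 by near: t; exact: nbhs_dnbhs_neq.
have {}Ht : `|f (t *: v + x) - f x - t *: v *m D| <= e / 2 / `|v| * (`|t| * `|v|).
  by near: t; apply: filterS H' => t /=; rewrite addrK normrZ.
have -> : v *m D - t^-1 *: (f (t *: v + x) - f x) =
    - t^-1 *: (f (t *: v + x) - f x - t *: v *m D).
  rewrite -scalemxAl [RHS]scalerBr scalerA mulNr mulVf// scaleN1r opprK scaleNr.
  by rewrite addrC.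
rewrite normrZ normrN normfV mulrC ltr_pdivrMr ?normr_gt0//.
apply: le_lt_trans Ht _.
rewrite [`|t| * _]mulrC mulrA divfK ?gt_eqF// ltr_pM2r ?normr_gt0//.
by rewrite ltr_pdivrMr// ltr_pMr// ltr1n.
Unshelve. all: by end_near. Qed.

Section ComplexCoordinates.
Context {R : realType}.
Local Notation C := (R[i]).
Implicit Types z w : C.

Definition realify n (z : 'rV[C]_n) : 'rV[R]_(n + n) :=
  row_mx (map_mx (@complex.Re R) z) (map_mx (@complex.Im R) z).

Definition complexify n (x : 'rV[R]_(n + n)) : 'rV[C]_n :=
  \row_j (x 0 (lshift n j) +i* x 0 (rshift n j))%C.

Lemma realifyK n : cancel (@realify n) (@complexify n).
Proof.
move=> z; apply/rowP => j; rewrite /realify mxE row_mxEl row_mxEr !mxE.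
by case: (z 0 j).
Qed.

Lemma complexifyK n : cancel (@complexify n) (@realify n).
Proof.
move=> x; apply/rowP => j; rewrite /realify.
by case: (split_ordP j) => k ->; rewrite ?row_mxEl ?row_mxEr !mxE.
Qed.

Lemma complexifyD n (x y : 'rV[R]_(n + n)) :
  complexify (x + y) = complexify x + complexify y.
Proof. by apply/rowP => j; rewrite !mxE. Qed.

Lemma complexifyZ n (a : R) (x : 'rV[R]_(n + n)) :
  complexify (a *: x) = (a%:C)%C *: complexify x.
Proof.
by apply/rowP => j; rewrite !mxE; apply/eqP; rewrite eq_complex /=;
   rewrite !mul0r subr0 addr0 !eqxx.
Qed.

Lemma complexify0 n : complexify (0 : 'rV[R]_(n + n)) = 0.
Proof. by apply/rowP => j; rewrite !mxE. Qed.

Lemma complexify_eq0 n (x : 'rV[R]_(n + n)) : (complexify x == 0) = (x == 0).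
Proof.
by rewrite -(can_eq (@realifyK n)) complexifyK -complexify0 complexifyK.
Qed.

Lemma complexify_std n (x : 'rV[R]_(n + n)) :
  complexify (x *m std_complex n) = 'i%C *: complexify x.
Proof.
rewrite -[x]hsubmxK mul_row_block !mulmx0 add0r addr0 mulmx1 mulmxN mulmx1.
apply/rowP => j; rewrite mxE row_mxEl row_mxEr [RHS]mxE.
rewrite [X in _ = _ * X]mxE row_mxEl row_mxEr !mxE.
by apply/eqP; rewrite eq_complex /=; rewrite !mul0r !mul1r sub0r add0r !eqxx.
Qed.

Definition nsq z : R := complex.Re z ^+ 2 + complex.Im z ^+ 2.

Lemma nsqM z w : nsq (z * w) = nsq z * nsq w.
Proof. by case: z w => [a b] [c d]; rewrite /nsq /=; ring. Qed.

Lemma nsq_eq0 z : (nsq z == 0) = (z == 0).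
Proof.
by rewrite /nsq paddr_eq0 ?sqr_ge0 // !sqrf_eq0 eq_complex.
Qed.

Lemma nsq_ge0 z : 0 <= nsq z.
Proof. by rewrite addr_ge0 ?sqr_ge0. Qed.

Section cCk.
Context {V : normedModType R} (O : set V).
Hypothesis oO : open O.

Definition cCk k (F : V -> C) : Prop :=
  Ck O k (fun x => complex.Re (F x)) /\ Ck O k (fun x => complex.Im (F x)).

Lemma cCk_ext k (F G : V -> C) :
  (forall x, O x -> F x = G x) -> cCk k F -> cCk k G.
Proof.
by move=> FG [F1 F2]; split; [apply: (Ck_ext oO _ F1)|apply: (Ck_ext oO _ F2)]
   => x Ox /=; rewrite FG.
Qed.

Lemma cCk_cst k z : cCk k (fun=> z).
Proof. by split; exact: Ck_cst. Qed.

Lemma cCkD k (F G : V -> C) : cCk k F -> cCk k G -> cCk k (fun x => F x + G x).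
Proof.
move=> [F1 F2] [G1 G2]; split.
  apply: (Ck_ext oO _ (CkD oO F1 G1)) => x _.
  by case: (F x) (G x) => [a b] [c d].
apply: (Ck_ext oO _ (CkD oO F2 G2)) => x _.
by case: (F x) (G x) => [a b] [c d].
Qed.

Lemma cCkM k (F G : V -> C) : cCk k F -> cCk k G -> cCk k (fun x => F x * G x).
Proof.
move=> [F1 F2] [G1 G2]; split.
  apply: (Ck_ext oO _ (CkD oO (CkM oO F1 G1) (CkN oO (CkM oO F2 G2)))) => x _.
  by case: (F x) (G x) => [a b] [c d].
apply: (Ck_ext oO _ (CkD oO (CkM oO F1 G2) (CkM oO F2 G1))) => x _.
by case: (F x) (G x) => [a b] [c d].
Qed.

Lemma cCk_nsq k (F : V -> C) : cCk k F -> Ck O k (fun x => nsq (F x)).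
Proof.
move=> [F1 F2].
by apply: (Ck_ext oO _ (CkD oO (CkM oO F1 F1) (CkM oO F2 F2))).
Qed.

Lemma cCkV k (F : V -> C) : (forall x, O x -> F x != 0) ->
  cCk k F -> cCk k (fun x => (F x)^-1).
Proof.
move=> F0 Fk; have [F1 F2] := Fk.
have ik : Ck O k (fun x => (nsq (F x))^-1).
  by apply: CkV => // [x Ox|]; [rewrite nsq_eq0; exact: F0|exact: cCk_nsq].
split.
  apply: (Ck_ext oO _ (CkM oO F1 ik)) => x _.
  by rewrite /nsq; case: (F x) => [a b].
apply: (Ck_ext oO _ (CkN oO (CkM oO F2 ik))) => x _.
by rewrite /nsq; case: (F x) => [a b].
Qed.

Lemma cCk_sum k (I : Type) (s : seq I) (F : I -> V -> C) :
  (forall i, cCk k (F i)) -> cCk k (fun x => \sum_(i <- s) F i x).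
Proof.
move=> Fk; elim: s => [|i s IH].
  by apply: (cCk_ext _ (cCk_cst k 0)) => x _; rewrite big_nil.
by apply: (cCk_ext _ (cCkD (Fk i) IH)) => x _; rewrite big_cons.
Qed.

Lemma Ck_realify k n (F : V -> 'rV[C]_n) :
  (forall j, cCk k (fun x => F x 0 j)) -> Ck O k (fun x => realify (F x)).
Proof.
move=> Fk; apply: Ck_row => // j; case: (split_ordP j) => l ->.
  apply: (Ck_ext oO _ (Fk l).1) => x _.
  by rewrite /realify row_mxEl mxE.
apply: (Ck_ext oO _ (Fk l).2) => x _.
by rewrite /realify row_mxEr mxE.
Qed.

End cCk.

Lemma cCk_coord n (O : set 'rV[R]_(n + n)) k j : open O ->
  cCk O k (fun x => complexify x 0 j).
Proof.
by move=> oO; split;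
  [apply: (Ck_ext oO _ (Ck_coord k (lshift n j) oO))
  |apply: (Ck_ext oO _ (Ck_coord k (rshift n j) oO))] => x _; rewrite mxE.
Qed.

Definition is_cderive (V : normedModType R) (x v : V) (F : V -> C) (d : C) :=
  is_derive x v (fun y => complex.Re (F y)) (complex.Re d) /\
  is_derive x v (fun y => complex.Im (F y)) (complex.Im d).

Section is_cderive.
Context {V : normedModType R} (x v : V).
Implicit Types F G : V -> C.

Lemma is_cderive_unique F G d e : (\near x, F x = G x) ->
  is_cderive x v F d -> is_cderive x v G e -> d = e.
Proof.
move=> FG [F1 F2] [G1 G2]; apply/eqP; rewrite eq_complex.
rewrite -(@derive_val _ _ _ _ _ _ _ F1) -(@derive_val _ _ _ _ _ _ _ F2).
rewrite -(@derive_val _ _ _ _ _ _ _ G1) -(@derive_val _ _ _ _ _ _ _ G2).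
apply/andP; split; apply/eqP; apply: near_eq_derive;
  by apply: filterS FG => y ->.
Qed.

Lemma is_cderive_cst z : is_cderive x v (fun=> z) 0.
Proof. by split; exact: is_derive_cst. Qed.

Lemma is_cderiveD F G d e : is_cderive x v F d -> is_cderive x v G e ->
  is_cderive x v (fun y => F y + G y) (d + e).
Proof.
move=> [F1 F2] [G1 G2]; split.
  have := is_deriveD F1 G1; rewrite (_ : _ + _ =
    (fun y => complex.Re (F y + G y))); last first.
    by apply/funext => y /=; rewrite fctE; case: (F y) (G y) => [? ?] [].
  by case: d e {F1 F2 G1 G2} => [? ?] [].
have := is_deriveD F2 G2; rewrite (_ : _ + _ =
  (fun y => complex.Im (F y + G y))); last first.
  by apply/funext => y /=; rewrite fctE; case: (F y) (G y) => [? ?] [].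
by case: d e {F1 F2 G1 G2} => [? ?] [].
Qed.

Lemma is_cderiveM F G d e : is_cderive x v F d -> is_cderive x v G e ->
  is_cderive x v (fun y => F y * G y) (d * G x + F x * e).
Proof.
move=> [F1 F2] [G1 G2]; split.
  have := is_deriveB (is_deriveM F1 G1) (is_deriveM F2 G2).
  rewrite (_ : _ - _ = (fun y => complex.Re (F y * G y))); last first.
    by apply/funext => y /=; rewrite !fctE; case: (F y) (G y) => [? ?] [].
  move=> H; apply: is_derive_eq H _; rewrite /GRing.scale /=.
  by case: d e (F x) (G x) {F1 F2 G1 G2} => [? ?] [? ?] [? ?] [? ?] /=; ring.
have := is_deriveD (is_deriveM F1 G2) (is_deriveM F2 G1).
rewrite (_ : _ + _ = (fun y => complex.Im (F y * G y))); last first.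
  by apply/funext => y /=; rewrite !fctE; case: (F y) (G y) => [? ?] [].
move=> H; apply: is_derive_eq H _; rewrite /GRing.scale /=.
by case: d e (F x) (G x) {F1 F2 G1 G2} => [? ?] [? ?] [? ?] [? ?] /=; ring.
Qed.

Lemma is_cderive_sum (I : Type) (s : seq I) (F : I -> V -> C) d :
  (forall i, is_cderive x v (F i) (d i)) ->
  is_cderive x v (fun y => \sum_(i <- s) F i y) (\sum_(i <- s) d i).
Proof.
move=> Fd; elim: s => [|i s IH].
  rewrite big_nil (_ : (fun _ => _) = fun=> 0); first exact: is_cderive_cst.
  by apply/funext => y; rewrite big_nil.
rewrite big_cons (_ : (fun _ => _) = fun y => F i y + \sum_(j <- s) F j y).
  exact: is_cderiveD.
by apply/funext => y; rewrite big_cons.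
Qed.

End is_cderive.

Lemma is_cderive_coord n (x v : 'rV[R]_(n + n)) j :
  is_cderive x v (fun y => complexify y 0 j) (complexify v 0 j).
Proof.
split; rewrite mxE /=.
  by under eq_fun do rewrite mxE /=; exact: is_derive_coord.
by under eq_fun do rewrite mxE /=; exact: is_derive_coord.
Qed.

End ComplexCoordinates.

(* Complex lines in C^(n+1), the space of row vectors. *)
Definition proj_space (R : realType) n : Type :=
  {L : {vspace 'rV[R[i]]_n.+1} | \dim L == 1%N}.

HB.instance Definition _ (R : realType) n :=
  SubChoice.copy (proj_space R n) {L : {vspace 'rV[R[i]]_n.+1} | \dim L == 1%N}.

Section ProjectiveSpace.
Context {R : realType} {n : nat}.
Local Notation C := (R[i]).
Local Notation P := (proj_space R n).
Local Notation E := ('rV[R]_(n.+1 + n.+1)).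
Implicit Types (L : P) (v w : 'rV[C]_n.+1).

Definition gen L : 'rV[C]_n.+1 := vpick (sval L).

Lemma gen_neq0 L : gen L != 0.
Proof. by rewrite vpick0 -dimv_eq0 (eqP (svalP L)). Qed.

Lemma gen_line L : sval L = <[gen L]>%VS.
Proof.
apply/esym/eqP; rewrite eqEdim -memvE memv_pick (eqP (svalP L)).
by rewrite dim_vline gen_neq0.
Qed.

Lemma line_inj v L L' : v != 0 -> v \in sval L -> v \in sval L' -> L = L'.
Proof.
move=> v0; suff H (K : P) : v \in sval K -> sval K = <[v]>%VS.
  by move=> /H e /H e'; apply: val_inj; rewrite /= e e'.
move=> vK; apply/esym/eqP; rewrite eqEdim -memvE vK (eqP (svalP K)).
by rewrite dim_vline v0.
Qed.

Fact line0_subproof :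
  \dim <[const_mx 1 : 'rV[C]_n.+1]>%VS == 1%N.
Proof.
rewrite dim_vline (_ : const_mx 1 != 0) //.
apply/eqP => /(congr1 (fun v : 'rV_n.+1 => v 0 0)) /eqP.
by rewrite !mxE oner_eq0.
Qed.

(* The line spanned by v, for v nonzero. *)
Definition line_through v : P :=
  insubd (exist (fun L : {vspace 'rV[C]_n.+1} => \dim L == 1%N) _ line0_subproof : P) <[v]>%VS.

Lemma line_throughE v : v != 0 -> sval (line_through v) = <[v]>%VS.
Proof. by move=> v0; rewrite /line_through val_insubd dim_vline v0. Qed.

Lemma mem_line_through v : v != 0 -> v \in sval (line_through v).
Proof. by move=> v0; rewrite line_throughE // memv_line. Qed.

Lemma line_throughP v L : v != 0 -> v \in sval L -> line_through v = L.
Proof. by move=> v0; apply: line_inj => //; exact: mem_line_through. Qed.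

Lemma line_through_gen L : line_through (gen L) = L.
Proof. by apply: line_throughP (gen_neq0 L) (memv_pick _). Qed.

Lemma gen_line_through v : v != 0 ->
  exists2 c : C, c != 0 & gen (line_through v) = c *: v.
Proof.
move=> v0; have : gen (line_through v) \in sval (line_through v).
  exact: memv_pick.
rewrite line_throughE // => /vlineP[c e]; exists c => //.
by apply: contraNneq (gen_neq0 (line_through v)) => c0; rewrite e c0 scale0r.
Qed.

Lemma line_throughZ (c : C) v : c != 0 -> v != 0 ->
  line_through (c *: v) = line_through v.
Proof.
move=> c0 v0; apply: line_throughP; first by rewrite scaler_eq0 negb_or c0.
by rewrite line_throughE //; apply/vlineP; exists c.
Qed.

(* The quotient topology of the space of nonzero vectors: a set of lines is
   open iff the nonzero vectors on these lines form an open subset. *)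
Definition cone (A : set P) : set E :=
  [set x | complexify x != 0 /\ exists2 L, A L & complexify x \in sval L].

Definition proj_open (A : set P) : Prop := open (cone A).

Lemma coneE (A : set P) (x : E) : complexify x != 0 ->
  cone A x = A (line_through (complexify x)).
Proof.
move=> x0; apply/propext; split=> [[_ [L AL xL]]|AL].
  by rewrite (line_throughP x0 xL).
by split=> //; eexists; [exact: AL|exact: mem_line_through].
Qed.

Lemma open_nonzero : open [set x : E | complexify x != 0].
Proof.
rewrite (_ : mkset _ = ~` [set 0]); last first.
  by apply/seteqP; split=> x /=; rewrite complexify_eq0 => /eqP.
by apply: closed_openC; apply: accessible_closed_set1; apply: hausdorff_accessible;
  exact: norm_hausdorff.
Qed.

Fact proj_openT : proj_open setT.
Proof.
rewrite /proj_open (_ : cone _ = [set x : E | complexify x != 0]).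
  exact: open_nonzero.
apply/seteqP; split=> x; first by case.
by move=> /= x0; rewrite coneE.
Qed.

Fact proj_openI : setI_closed proj_open.
Proof.
move=> A B oA oB; rewrite /proj_open (_ : cone _ = cone A `&` cone B).
  exact: openI.
apply/seteqP; split=> x; first by move=> [x0 [L [AL BL] xL]]; split; split=> //;
  exists L.
by move=> [[x0 AL] [_ BL]]; rewrite coneE//; split; rewrite -coneE.
Qed.

Fact proj_open_bigU (I : Type) (f : I -> set P) :
  (forall i, proj_open (f i)) -> proj_open (\bigcup_i f i).
Proof.
move=> fo; rewrite /proj_open (_ : cone _ = \bigcup_i cone (f i)).
  by apply: bigcup_open => i _; exact: fo.
apply/seteqP; split=> x.
  by move=> [x0 [L [i _ fL] xL]]; exists i => //; split=> //; exists L.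
by move=> [i _ [x0 [L fL xL]]]; split=> //; exists L => //; exists i.
Qed.

HB.instance Definition _ := isOpenTopological.Build P
  proj_openT proj_openI proj_open_bigU.

Definition quot (x : E) : P := line_through (complexify x).

Lemma quot_continuous (x : E) : x != 0 -> {for x, continuous quot}.
Proof.
rewrite -complexify_eq0 => x0 A; rewrite nbhsE => -[B [oB Bx] BA].
have oc : open (cone B) by exact: oB.
have cx : cone B x by rewrite coneE.
apply: filterS (open_nbhs_nbhs (conj oc cx)) => y Cy; apply: BA.
by have [y0 _] := Cy; rewrite -[B _](coneE B y0).
Qed.

Lemma proj_continuous (T : topologicalType) (D : set P) (f : P -> T) (F : E -> T) :
  (forall x, complexify x != 0 -> D (quot x) -> F x = f (quot x)) ->
  open D -> (forall x, cone D x -> {for x, continuous F}) ->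
  forall L, D L -> {for L, continuous f}.
Proof.
move=> Ff oD Fc L DL A; rewrite nbhsE => -[B [oB Bx] BA].
rewrite nbhsE; exists (D `&` f @^-1` B); last by move=> K [_ /BA].
split; last by split.
have oc : open (cone D) by exact: oD.
have : open (cone D `&` F @^-1` B).
  rewrite openE => x [Dx Fx]; have := Fc x Dx B (open_nbhs_nbhs (conj oB Fx)).
  by move=> nF; apply: filterI; [exact: open_nbhs_nbhs|exact: nF].
suff -> : cone D `&` F @^-1` B = cone (D `&` f @^-1` B) by [].
apply/seteqP; split=> x.
  move=> [[x0 Dx] /= Bx']; rewrite coneE//; split; first by rewrite -coneE.
  by rewrite /= -[line_through _]/(quot x) -Ff// -coneE.
move=> [x0 Dx]; have : (D `&` f @^-1` B) (quot x) by rewrite -[_ (quot _)]coneE.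
by move=> [Dqx fx]; split; [rewrite coneE|rewrite /= Ff].
Qed.

Lemma quot_gen L : quot (realify (gen L)) = L.
Proof. by rewrite /quot realifyK line_through_gen. Qed.

Lemma proj_compact : compact [set: P].
Proof.
pose S := [set x : E | `|x| = 1].
have cS : compact S.
  apply: bounded_closed_compact; first by exists 1; split => // r r1 x x1 /=; rewrite (x1 : `|x| = 1) ltW.
  have /continuous_closedP : continuous (fun x : E => `|x|) by exact: norm_continuous.
  move=> /(_ [set 1]); apply.
  by apply: accessible_closed_set1; apply: hausdorff_accessible; exact: Rhausdorff.
have <- : quot @` S = [set: P].
  apply/seteqP; split=> // L _; pose g := realify (gen L).
  have g0 : g != 0 by rewrite -complexify_eq0 realifyK gen_neq0.
  exists (`|g|^-1 *: g).
    by rewrite /S /= normrZ normfV normr_id mulVf // normr_eq0.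
  rewrite /quot complexifyZ line_throughZ ?realifyK ?line_through_gen ?gen_neq0 //.
  by rewrite eq_complex /= negb_and invr_eq0 normr_eq0 g0.
apply: continuous_compact => //; apply: continuous_in_subspaceT => x.
rewrite inE => /= x1; apply: quot_continuous.
by rewrite -normr_eq0 x1 oner_eq0.
Qed.

(* The affine chart {v_i <> 0} -> C^n, v |-> (v_j / v_i)_(j <> i). *)
Definition homogeneous (i : 'I_n.+1) (z : 'rV[C]_n) : 'rV[C]_n.+1 :=
  \row_j (if unlift i j is Some k then z 0 k else 1).

Definition dehomogenize (i : 'I_n.+1) v : 'rV[C]_n :=
  \row_k (v 0 (lift i k) / v 0 i).

Definition affine_dom i : set P := [set L | gen L 0 i != 0].
Definition affine_coord i L : 'rV[R]_(n + n) := realify (dehomogenize i (gen L)).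
Definition affine_param i (x : 'rV[R]_(n + n)) : P :=
  line_through (homogeneous i (complexify x)).

Lemma homogeneous_neq0 i z : homogeneous i z != 0.
Proof.
apply/eqP => /(congr1 (fun v : 'rV_n.+1 => v 0 i)) /eqP.
by rewrite !mxE unlift_none oner_eq0.
Qed.

Lemma homogeneousK i : cancel (homogeneous i) (dehomogenize i).
Proof.
by move=> z; apply/rowP => k; rewrite !mxE liftK unlift_none divr1.
Qed.

Lemma dehomogenizeK i v : v 0 i != 0 ->
  homogeneous i (dehomogenize i v) = (v 0 i)^-1 *: v.
Proof.
move=> vi; apply/rowP => j; rewrite !mxE; case: unliftP => [k|] ->.
  by rewrite mxE mulrC.
by rewrite mulVf.
Qed.

Lemma dehomogenizeZ i (c : C) v : c != 0 ->
  dehomogenize i (c *: v) = dehomogenize i v.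
Proof.
by move=> c0; apply/rowP => k; rewrite !mxE -mulf_div divff // mul1r.
Qed.

Lemma affine_dom_through i v : v != 0 ->
  affine_dom i (line_through v) = (v 0 i != 0).
Proof.
move=> v0; have [c c0 e] := gen_line_through v0.
by rewrite /affine_dom /= e mxE mulf_eq0 negb_or c0.
Qed.

Lemma affine_coord_through i v : v != 0 ->
  affine_coord i (line_through v) = realify (dehomogenize i v).
Proof.
move=> v0; have [c c0 e] := gen_line_through v0.
by rewrite /affine_coord e dehomogenizeZ.
Qed.

Lemma affine_dom_param i x : affine_dom i (affine_param i x).
Proof.
rewrite /affine_param affine_dom_through ?homogeneous_neq0//.
by rewrite mxE unlift_none oner_neq0.
Qed.

Lemma affine_paramK i : cancel (affine_param i) (affine_coord i).
Proof.
move=> x; rewrite affine_coord_through ?homogeneous_neq0//.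
by rewrite homogeneousK complexifyK.
Qed.

Lemma affine_coordK i L : affine_dom i L -> affine_param i (affine_coord i L) = L.
Proof.
move=> iL; rewrite /affine_param /affine_coord realifyK dehomogenizeK//.
by rewrite line_throughZ ?invr_eq0 ?gen_neq0// line_through_gen.
Qed.

Lemma affine_image i : affine_coord i @` affine_dom i = setT.
Proof.
apply/seteqP; split=> // x _; exists (affine_param i x); last exact: affine_paramK.
exact: affine_dom_param.
Qed.

Lemma complex_continuous (V : normedModType R) m (O : set V) (F : V -> 'rV[C]_m) :
  open O -> (forall j, cCk O 0 (fun x => F x 0 j)) ->
  forall x, O x -> {for x, continuous (fun x => realify (F x))}.
Proof.
by move=> oO Fk x Ox; apply: (Ck_continuous (k := 0) (O := O)) Ox; apply: Ck_realify.
Qed.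

Lemma open_cCk (V : normedModType R) (O : set V) (F : V -> C) :
  open O -> cCk O 0 F -> open (O `&` [set x | F x != 0]).
Proof.
move=> oO Fk; rewrite openE => x [Ox Fx]; apply: filterI.
  exact: open_nbhs_nbhs.
have /(_ _ Ox) cF := Ck_continuous (cCk_nsq oO Fk).
have o0 : open [set r : R | r != 0] by exact: open_neq.
have Fx0 : nsq (F x) != 0 by rewrite nsq_eq0.
have : nbhs x ((fun y => nsq (F y)) @^-1` [set r : R | r != 0]).
  by apply: cF; exact: open_nbhs_nbhs (conj o0 Fx0).
by apply: filterS => y /=; rewrite nsq_eq0.
Qed.

Lemma open_affine_dom i : open (affine_dom i).
Proof.
suff -> : @open P (affine_dom i) = open (setT `&` [set x : E | complexify x 0 i != 0]).
  by apply: open_cCk; [exact: openT|apply: cCk_coord; exact: openT].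
rewrite setTI /open /= /proj_open; congr open; apply/seteqP; split=> x.
  move=> Cx; have [x0 _] := Cx; move: Cx; rewrite coneE//.
  by rewrite affine_dom_through.
move=> /= xi; have x0 : complexify x != 0.
  by apply: contraNneq xi => ->; rewrite mxE.
by rewrite coneE// affine_dom_through.
Qed.

Lemma cCk_homogeneous (O : set 'rV[R]_(n + n)) k i j : open O ->
  cCk O k (fun x => homogeneous i (complexify x) 0 j).
Proof.
move=> oO; case: (unliftP i j) => [l|] ->.
  apply: (cCk_ext oO _ (cCk_coord k l oO)) => x _.
  by rewrite [RHS]mxE liftK.
apply: (cCk_ext oO _ (cCk_cst oO k 1)) => x _.
by rewrite mxE unlift_none.
Qed.

Lemma affine_coord_continuous i : {within affine_dom i, continuous (affine_coord i)}.
Proof.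
apply: continuous_in_subspaceT => L; rewrite inE.
apply: (proj_continuous (F := fun x : E => realify (dehomogenize i (complexify x)))).
- by move=> x x0 _; rewrite /quot affine_coord_through.
- exact: open_affine_dom.
have oO : open (cone (affine_dom i)) by exact: open_affine_dom.
apply: complex_continuous => // k.
apply: (cCk_ext oO (F := fun x => complexify x 0 (lift i k) * (complexify x 0 i)^-1)).
  by move=> x _; rewrite [RHS]mxE.
apply: cCkM => //; first exact: cCk_coord.
apply: cCkV => //; last exact: cCk_coord.
by move=> x Cx; have [x0 _] := Cx; move: Cx; rewrite coneE// affine_dom_through.
Qed.

Lemma affine_param_continuous i : continuous (affine_param i).
Proof.
move=> x; have -> : affine_param i = quot \o (fun x => realify (homogeneous i (complexify x))).
  by apply/funext => y; rewrite /quot /= realifyK.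
apply: continuous_comp; last first.
  by apply: quot_continuous; rewrite -complexify_eq0 realifyK homogeneous_neq0.
apply: (@complex_continuous _ _ setT) => // [|j]; first exact: openT.
by apply: cCk_homogeneous; exact: openT.
Qed.

Lemma affine_chart_image i : exists2 O : set 'rV[R]_(n + n),
  open O & affine_coord i @` affine_dom i = O `&` setT.
Proof. by exists setT; [exact: openT|rewrite affine_image setIT]. Qed.

Definition affine_chart i : chart P [set: 'rV[R]_(n + n)] :=
  Chart (@open_affine_dom i) (@affine_chart_image i) (@affine_coordK i)
        (affine_coord_continuous (i := i))
        (continuous_subspaceT (affine_param_continuous (i := i))).

Definition sqnorm v : R := \sum_j nsq (v 0 j).

Lemma sqnorm_gt0 v : v != 0 -> 0 < sqnorm v.
Proof.
move=> v0; rewrite lt0r sumr_ge0 ?andbT; last by move=> j _; exact: nsq_ge0.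
apply: contra v0; rewrite psumr_eq0; last by move=> j _; exact: nsq_ge0.
move=> /allP H; apply/eqP/rowP => j; apply/eqP; rewrite mxE -nsq_eq0.
by apply: H; rewrite mem_index_enum.
Qed.

Lemma sqnormZ (c : C) v : sqnorm (c *: v) = nsq c * sqnorm v.
Proof. by rewrite /sqnorm mulr_sumr; apply: eq_bigr => j _; rewrite mxE nsqM. Qed.

(* A continuous function vanishing at the line through v. *)
Definition separator v i j w : R :=
  nsq (w 0 i * v 0 j - w 0 j * v 0 i) / sqnorm w.

Lemma separator_continuous v i j :
  continuous (fun L : P => separator v i j (gen L)).
Proof.
move=> L; apply: (proj_continuous (D := setT)
  (F := fun x : E => separator v i j (complexify x))) => //.
- move=> x x0 _; have [c c0 e] := gen_line_through x0.
  rewrite /quot e /separator sqnormZ !mxE -!mulrA -mulrBr nsqM.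
  by rewrite -mulf_div divff ?nsq_eq0// mul1r.
- exact: openT.
have oO : open (cone setT) by exact: proj_openT.
move=> x Cx; apply: (Ck_continuous (k := 0) (O := cone setT)) Cx.
apply: (Ck_ext oO (f := fun x : E =>
   nsq (complexify x 0 i * v 0 j + complexify x 0 j * - v 0 i) *
   (sqnorm (complexify x))^-1)).
  by move=> y _; rewrite mulrN.
apply: CkM => //.
  apply: cCk_nsq => //; apply: cCkD => //; apply: cCkM => //;
    by [exact: cCk_coord|exact: cCk_cst].
apply: CkV => // [y [y0 _]|]; first by rewrite gt_eqF// sqnorm_gt0.
rewrite /sqnorm; elim: (index_enum _) => [|l s IH].
  by apply: (Ck_ext oO _ (Ck_cst oO 0 0)) => y _; rewrite big_nil.
apply: (Ck_ext oO _ (CkD oO (cCk_nsq oO (cCk_coord 0 l oO)) IH)) => y _.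
by rewrite big_cons.
Qed.

Lemma proj_hausdorff : hausdorff_space P.
Proof.
move=> L L' LL'; pose v := gen L; pose w := gen L'.
have sep i j : separator v i j v = separator v i j w.
  apply: (@Rhausdorff R) => A B nA nB.
  have [K [KA KB]] := LL' _ _ (separator_continuous (v := v) (i := i) (j := j) nA)
    (separator_continuous (v := v) (i := i) (j := j) nB).
  by exists (separator v i j (gen K)).
have minor i j : w 0 i * v 0 j = w 0 j * v 0 i.
  apply/eqP; rewrite -subr_eq0 -nsq_eq0.
  have := sep i j; rewrite {1}/separator [v 0 i * _]mulrC subrr.
  rewrite (_ : nsq 0 = 0) ?mul0r; last by rewrite /nsq /= expr0n addr0.
  move=> /esym/eqP; rewrite /separator mulf_eq0 invr_eq0.
  by rewrite [X in _ || X]gt_eqF ?orbF// sqnorm_gt0// gen_neq0.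
have /rV0Pn[a va] : v != 0 by exact: gen_neq0.
apply: (@line_inj w); [exact: gen_neq0| |exact: memv_pick].
rewrite (gen_line L); apply/vlineP; exists (w 0 a / v 0 a).
apply/rowP => j; rewrite mxE mulrAC -/v minor -mulrA divff// mulr1.
by [].
Qed.

Section Linear.
Variable A : 'M[C]_n.+1.
Hypothesis A_unit : A \in unitmx.

Let den i j (x : 'rV[R]_(n + n)) : C := (homogeneous i (complexify x) *m A) 0 j.

Definition linear_local i j (x : 'rV[R]_(n + n)) : 'rV[R]_(n + n) :=
  realify (dehomogenize j (homogeneous i (complexify x) *m A)).

Definition linear_dom i j : set 'rV[R]_(n + n) := [set x | den i j x != 0].

Lemma cCk_den (O : set 'rV[R]_(n + n)) k i j : open O -> cCk O k (den i j).
Proof.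
move=> oO; apply: (cCk_ext oO (F := fun x =>
  \sum_l homogeneous i (complexify x) 0 l * A l j)) => [x _|].
  by rewrite /den [RHS]mxE.
apply: cCk_sum => // l; apply: cCkM => //; first exact: cCk_homogeneous.
exact: cCk_cst.
Qed.

Lemma open_linear_dom i j : open (linear_dom i j).
Proof.
rewrite -[linear_dom i j]setTI; apply: open_cCk; first exact: openT.
by apply: cCk_den; exact: openT.
Qed.

Lemma Ck_linear_local k i j : Ck (linear_dom i j) k (linear_local i j).
Proof.
have oO := @open_linear_dom i j.
apply: Ck_realify => // l; apply: (cCk_ext oO
  (F := fun x => den i (lift j l) x * (den i j x)^-1)).
  by move=> x _; rewrite [RHS]mxE.
apply: cCkM => //; first exact: cCk_den.
by apply: cCkV => //; exact: cCk_den.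
Qed.

Lemma is_cderive_den i j x h :
  is_cderive x h (den i j) (den i j h - den i j 0).
Proof.
have -> : den i j = fun x => \sum_l homogeneous i (complexify x) 0 l * A l j.
  by apply/funext => y; rewrite /den mxE.
rewrite -sumrB; apply: is_cderive_sum => l.
have H : is_cderive x h (fun y => homogeneous i (complexify y) 0 l)
    (homogeneous i (complexify h) 0 l - homogeneous i (complexify 0) 0 l).
  case: (unliftP i l) => [m|] ->.
    have -> : (fun y : 'rV[R]_(n+n) => homogeneous i (complexify y) 0 (lift i m)) =
      (fun y => complexify y 0 m) by apply/funext => y; rewrite [LHS]mxE liftK.
    have E y : homogeneous i (complexify y) 0 (lift i m) = complexify y 0 m.
      by rewrite [LHS]mxE liftK.
    by rewrite !E complexify0 [(0 : 'rV[C]_n) 0 m]mxE subr0; exact: is_cderive_coord.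
  have E y : homogeneous i y 0 i = 1 by rewrite mxE unlift_none.
  under [in X in is_cderive _ _ X _]eq_fun do rewrite E.
  by rewrite !E subrr; exact: is_cderive_cst.
have := is_cderiveM H (is_cderive_cst x h (A l j)).
by rewrite mulr0 addr0 mulrBl.
Qed.

Lemma den_lin i j h : den i j (h *m std_complex n) - den i j 0 =
  'i%C * (den i j h - den i j 0).
Proof.
rewrite /den complexify_std complexify0.
have e v w : (v *m A) 0 j - (w *m A) 0 j = ((v - w) *m A) 0 j.
  by rewrite mulmxBl [RHS]mxE [X in _ = _ + X]mxE.
rewrite !e; suff -> : homogeneous i ('i%C *: complexify h) - homogeneous i 0 =
    'i%C *: (homogeneous i (complexify h) - homogeneous i 0).
  by rewrite -scalemxAl mxE.
apply/rowP => l; rewrite !mxE; case: (unlift i l) => [m|]; rewrite ?mxE.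
  by rewrite subr0 subr0.
by rewrite !subrr mulr0.
Qed.

Lemma linear_local_derivative i j x (D : 'M[R]_(n + n)) U :
  linear_dom i j x -> open U -> U x ->
  diff_within U (linear_local i j) x D ->
  std_complex n *m D = D *m std_complex n.
Proof.
move=> dx oU Ux dD.
have dir h : is_derive x h (linear_local i j) (h *m D).
  exact: diff_within_derive dD.
have cdir h l : is_cderive x h (fun y => complexify (linear_local i j y) 0 l)
    (complexify (h *m D) 0 l).
  split; rewrite mxE /=; under eq_fun do rewrite mxE /=;
    exact: is_derive_coord_of (dir h).
have key h l : complexify (h *m D) 0 l =
   ((den i (lift j l) h - den i (lift j l) 0) -
    (den i j h - den i j 0) * complexify (linear_local i j x) 0 l) / den i j x.
  have := is_cderiveM (is_cderive_den i j x h) (cdir h l).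
  have nearE : \forall y \near x,
      den i j y * complexify (linear_local i j y) 0 l = den i (lift j l) y.
    apply: filterS (open_nbhs_nbhs (conj (@open_linear_dom i j) dx)) => y dy.
    by rewrite /linear_local realifyK mxE mulrC divfK.
  move=> /(is_cderive_unique nearE)/(_ (is_cderive_den _ _ _ _)) <-.
  by rewrite addrAC subrr add0r mulrAC divff// mul1r.
apply/row_matrixP => r; rewrite !row_mul.
have /(congr1 (@realify R n)) : complexify (row r (std_complex n) *m D) =
    complexify (row r D *m std_complex n).
  rewrite !rowE complexify_std; apply/rowP => l.
  rewrite [RHS]mxE !key !den_lin; set a := 'i%C; set b := den i j x.
  by rewrite -(mulrA a) -mulrBr mulrA.
by rewrite !complexifyK.
Qed.

End Linear.
End ProjectiveSpace.

Section ProjectiveManifold.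
Context {R : realType} {n : nat}.
Local Notation C := (R[i]).
Local Notation P := (proj_space R n).

(* The action on lines of v |-> v *m A. *)
Definition linear_act (A : 'M[C]_n.+1) (L : P) : P := line_through (gen L *m A).

Section LinearAct.
Variable A : 'M[C]_n.+1.
Hypothesis A_unit : A \in unitmx.

Lemma mulmx_unit_neq0 (v : 'rV[C]_n.+1) : v != 0 -> v *m A != 0.
Proof.
by apply: contraNneq => vA; rewrite -(mulmxK A_unit v) vA mul0mx.
Qed.

Lemma linear_act_through (v : 'rV[C]_n.+1) : v != 0 ->
  linear_act A (line_through v) = line_through (v *m A).
Proof.
move=> v0; have [c c0 e] := gen_line_through v0.
by rewrite /linear_act e -scalemxAl line_throughZ// mulmx_unit_neq0.
Qed.

Lemma linear_act_continuous : continuous (linear_act A).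
Proof.
move=> L; apply: (proj_continuous (D := setT)
  (F := fun x => quot (realify (complexify x *m A)))) => //.
- by move=> x x0 _; rewrite /quot realifyK linear_act_through.
- exact: openT.
move=> x Cx; have [x0 _] := Cx.
have oO : open (cone [set: P]) by exact: proj_openT.
apply: (@continuous_comp _ _ _ (fun x => realify (complexify x *m A)) quot).
  apply: (complex_continuous oO) Cx => j.
  apply: (cCk_ext oO (F := fun x => \sum_l complexify x 0 l * A l j)) => [y _|].
    by rewrite [RHS]mxE.
  apply: cCk_sum => // l; apply: cCkM => //; first exact: cCk_coord.
  exact: cCk_cst.
apply: quot_continuous; rewrite -complexify_eq0 realifyK.
exact: mulmx_unit_neq0.
Qed.

Lemma linear_act_local i j x :
  affine_coord j (linear_act A (affine_param i x)) = linear_local A i j x.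
Proof.
rewrite /affine_param linear_act_through ?homogeneous_neq0//.
by rewrite affine_coord_through// mulmx_unit_neq0// homogeneous_neq0.
Qed.

Lemma linear_act_dom i j :
  affine_coord i @` (affine_dom i `&` linear_act A @^-1` affine_dom j) =
  linear_dom A i j.
Proof.
have E x : affine_dom j (linear_act A (affine_param i x)) = linear_dom A i j x.
  rewrite /affine_param linear_act_through ?homogeneous_neq0//.
  by rewrite affine_dom_through// mulmx_unit_neq0// homogeneous_neq0.
apply/seteqP; split=> [_ [L [iL jL] <-]|x dx].
  by rewrite -E affine_coordK.
exists (affine_param i x); last exact: affine_paramK.
by split; [exact: affine_dom_param|rewrite /= E].
Qed.

Lemma smooth_linear_act i j :
  smooth_on (affine_coord i @` (affine_dom i `&` linear_act A @^-1` affine_dom j))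
            (affine_coord j \o linear_act A \o affine_param i).
Proof.
rewrite linear_act_dom => x dx; exists (linear_dom A i j), (linear_local A i j).
split=> // [|k|y _ _]; [exact: open_linear_dom|exact: Ck_linear_local|].
exact: linear_act_local.
Qed.

Lemma tangent_linear_act i j L (D : 'M[R]_(n + n)) :
  affine_dom i L -> affine_dom j (linear_act A L) ->
  diff_within (affine_coord i @` (affine_dom i `&` linear_act A @^-1` affine_dom j))
    (affine_coord j \o linear_act A \o affine_param i) (affine_coord i L) D ->
  std_complex n *m D = D *m std_complex n.
Proof.
move=> iL jL dD.
have dx : linear_dom A i j (affine_coord i L) by rewrite -linear_act_dom; exists L.
apply: (@linear_local_derivative _ _ A i j _ D (linear_dom A i j) dx _ dx).
  exact: open_linear_dom.
rewrite linear_act_dom in dD; move=> e /dD; congr (within _ _ _).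
by apply/funext => y; rewrite -!linear_act_local.
Qed.

End LinearAct.

Lemma linear_act1 : linear_act 1%:M = id.
Proof. by apply/funext => L; rewrite /linear_act mulmx1 line_through_gen. Qed.

Lemma proj_cover (L : P) : exists i, dom (affine_chart i) L.
Proof. by have /rV0Pn [k Lk] := gen_neq0 L; exists k. Qed.

Lemma proj_transition i j :
  smooth_on (affine_chart i @` (dom (affine_chart i) `&` dom (affine_chart j)))
            (affine_chart j \o param (affine_chart i) : _ -> 'rV[R]_(n + n)).
Proof.
by have := @smooth_linear_act 1%:M (unitmx1 _ _) i j; rewrite linear_act1.
Qed.

(* The projective space P(C^(n+1)) as a manifold of real dimension 2n. *)
Definition proj_mfd : compact_mfd [set: 'rV[R]_(n + n)] :=
  CompactMfd proj_hausdorff proj_compact proj_cover proj_transition.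

End ProjectiveManifold.
Arguments proj_mfd : clear implicits.

Section Projectivization.
Context {R : realType}.
Local Notation C := (R[i]).

(* Complex representations of C_2 on C^n, given by the matrix through which
   the generator acts on row vectors. *)
Record C2_rep n := C2Rep {
  rep_mx : 'M[C]_n ;
  rep_mx_sqr : rep_mx *m rep_mx = 1%:M }.

Definition trivial_rep n : C2_rep n := C2Rep (mulmx1 1%:M).

Fact sign_rep_subproof : (- 1%:M : 'M[C]_1) *m - 1%:M = 1%:M.
Proof. by rewrite mulNmx mulmxN opprK mulmx1. Qed.
Definition sign_rep : C2_rep 1 := C2Rep sign_rep_subproof.

Fact sum_rep_subproof m n (V : C2_rep m) (W : C2_rep n) :
  block_mx (rep_mx V) 0 0 (rep_mx W) *m block_mx (rep_mx V) 0 0 (rep_mx W) = 1%:M.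
Proof.
rewrite mulmx_block !mulmx0 !mul0mx !addr0 add0r !rep_mx_sqr.
by rewrite -scalar_mx_block.
Qed.
Definition sum_rep m n (V : C2_rep m) (W : C2_rep n) : C2_rep (m + n) :=
  C2Rep (sum_rep_subproof V W).

Section Proj.
Variables (n : nat) (V : C2_rep n.+1).

Lemma rep_mx_unit : rep_mx V \in unitmx.
Proof. by case/mulmx1_unit: (rep_mx_sqr V). Qed.

Definition proj_flip : proj_mfd R n -> proj_mfd R n := linear_act (rep_mx V).

Lemma proj_flip_smooth : smooth_map proj_flip.
Proof.
split; first exact: linear_act_continuous rep_mx_unit.
exact: smooth_linear_act rep_mx_unit.
Qed.

Lemma proj_flipK : involutive proj_flip.
Proof.
move=> L; rewrite /proj_flip {2}/linear_act linear_act_through ?rep_mx_unit//.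
  by rewrite -mulmxA rep_mx_sqr mulmx1 line_through_gen.
by rewrite mulmx_unit_neq0 ?rep_mx_unit ?gen_neq0.
Qed.

Definition proj_C2_mfd : C2_mfd [set: 'rV[R]_(n + n)] :=
  C2Mfd proj_flip_smooth proj_flipK.

(* Affine coordinates are holomorphic: the complex structure is the standard one
   in each affine chart. *)
Definition proj_complex (i : chart_index proj_C2_mfd) (L : proj_C2_mfd) :
  'M[R]_(n + n) := std_complex n.

Lemma std_complex_sqr : std_complex n *m std_complex n = - 1%:M :> 'M[R]_(n + n).
Proof.
rewrite mulmx_block !mulmx0 !mul0mx !addr0 !add0r mulmx1 mul1mx.
by rewrite scalar_mx_block opp_block_mx oppr0.
Qed.

Lemma stab0 m p (D : 'M[R]_(m, p)) : stab 0 D = D.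
Proof.
apply/matrixP => i j.
have ei : i = @rshift 0 m i by exact: val_inj.
have ej : j = @rshift 0 p j by exact: val_inj.
by rewrite [in LHS]ei [in LHS]ej [LHS]block_mxEdr.
Qed.

Lemma proj_complexP :
  @equivariant_complex_structure R (n + n) _ proj_C2_mfd 0 proj_complex.
Proof.
split.
- move=> i x _; exists setT, (fun=> std_complex n).
  by split=> // [|k]; [exact: openT|apply: Ck_cst; exact: openT].
- by move=> i p _; exact: std_complex_sqr.
- move=> i j p D [ip jp]; rewrite stab0.
  rewrite /local_dom /local_expr -[id](@linear_act1 R n).
  by apply: tangent_linear_act => //; [exact: unitmx1|rewrite linear_act1].
- move=> i j p D [ip jp]; rewrite stab0.
  by apply: tangent_linear_act => //; exact: rep_mx_unit.
Qed.

(* P(V) as a complex C_2-manifold. *)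
Definition projectivization : complex_C2_mfd (n + n) :=
  ComplexC2Mfd proj_complexP.

End Proj.
End Projectivization.
Arguments trivial_rep : clear implicits.
Arguments sign_rep : clear implicits.

(* Main.v *)
From HB Require Import structures.
Require Import Defs.
From mathcomp Require Import reals.
From mathcomp Require Import all_boot all_order all_algebra.
From mathcomp Require Import all_classical all_reals all_analysis.
From mathcomp Require Import complex ring lra zify.

(** Let W be an equivariant cobordism between the two planes; it has real
dimension 5.  At a fixed point p of the involution of W, the differential of the
involution is itself an involution of the tangent space, and near p the fixed
set is a submanifold whose tangent space is the (+1)-eigenspace.  Let X be the
set of the fixed points at which this eigenspace is a line.  The dimension of
the eigenspace is locally constant along the fixed set, so X is a compact
1-manifold, and its end points are the points of X on the boundary of W.

Which boundary points are in X?  At a boundary point the tangent space of W is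
that of the boundary plus one normal direction, so the (+1)-eigenspace in W is
at most one dimension larger than the one in the boundary, and at least as
large.  On P(C^3) the involution is trivial and the eigenspace in the boundary
has real dimension 4: no point of P(C^3) is in X.  The fixed set of
P(C^2 + C^sigma) consists of a projective line, where the eigenspace in the
boundary has real dimension 2, and of the isolated point [0 : 0 : 1], where it
is 0.  The isolated point is in X, because an involution which preserves W
cannot reverse the inward normal direction.  Hence X is a compact 1-manifold
with exactly one end point, and there is no such manifold.

The steps are carried by the following lemmas.
- [single_end_absurd] is the statement about 1-manifolds.  It pushes a point
  that cuts the manifold in two away from the end point, through a finite cover
  by arcs: every push swallows at least one more arc of the cover, but the
  cutting point always lies in an arc which has not been swallowed.
- [fixed_curve] shows that the fixed set is a curve where the eigenspace is a
  line.  An involution is close to its differential L in the strict sense, so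
  that a contraction argument solves all components of f x = x except the one
  along the fixed line of L; the relation f (f x) = x takes care of that one.
- The dimension r of the eigenspace of an involution of R^n is read off the
  trace, which is 2 r - n.  Traces do not depend on charts
  ([flip_tangent_trace]), are locally constant ([flip_trace_near]) and change by
  1 or -1 from the boundary to W ([extension_trace]).
- [boundary_column] and [flip_inward] use that W lies on one side of its
  boundary; with them [inward_line] finds the fixed line at the isolated
  point. *)

Set Implicit Arguments.
Unset Strict Implicit.
Unset Printing Implicit Defensive.

Import Order.TTheory GRing.Theory Num.Theory.
Import numFieldNormedType.Exports.

Local Open Scope classical_set_scope.
Local Open Scope ring_scope.

(** * Compact 1-manifolds with a single end point *)

Section OneManifold.
Context {R : realType} {T : topologicalType} (X : set T).

(** The subset J of R, an interval in practice, parametrizes X near some point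
by g, with inverse h.  The coordinate h lives on an open subset U of T, not only
on X: its continuity then makes the image under g of an open subset of J
relatively open in X. *)
Record parametrizes (J : set R) (U : set T) (g : R -> T) (h : T -> R) : Prop :=
  Parametrizes {
    par_open : open U ;
    par_in : forall t, J t -> (X `&` U) (g t) ;
    parK : forall t, J t -> h (g t) = t ;
    par_coord : forall y, (X `&` U) y -> J (h y) ;
    par_coordK : forall y, (X `&` U) y -> g (h y) = y ;
    par_continuous : {within J, continuous g} ;
    par_coord_continuous : {in U, continuous h} }.

Lemma parametrizes_opp (U : set T) (g : R -> T) (h : T -> R) :
  parametrizes `]-1, 1[ U g h ->
  parametrizes `]-1, 1[ U (fun t => g (- t)) (fun y => - h y).
Proof.
have oppJ (t : R) : `]-1, 1[%classic t -> `]-1, 1[%classic (- t).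
  by rewrite /= !in_itv /= => /andP[? ?]; apply/andP; split; lra.
move=> P; have oJ : open (`]-1, 1[%classic : set R) by exact: interval_open.
split.
- exact: par_open P.
- by move=> t /oppJ/(par_in P).
- by move=> t /oppJ/(parK P) ->; rewrite opprK.
- by move=> y /(par_coord P)/oppJ.
- by move=> y Uy; rewrite opprK (par_coordK P Uy).
- have := par_continuous P; rewrite !continuous_open_subspace// => cg t tJ.
  apply: (@continuous_comp _ _ _ (@GRing.opp R) g); first exact: opp_continuous.
  by apply: cg; rewrite inE; apply: oppJ; rewrite inE in tJ.
- move=> y Uy; apply: (@continuous_comp _ _ _ h (@GRing.opp R)).
    exact: par_coord_continuous P _ Uy.
  exact: opp_continuous.
Qed.

Lemma open_coord_preimage J U g h (V : set R) :
  parametrizes J U g h -> open V -> open (U `&` h @^-1` V).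
Proof.
move=> P oV; rewrite openE => y [Uy Vy]; apply: filterI.
  by apply: open_nbhs_nbhs; split => //; exact: par_open P.
by apply: (par_coord_continuous P (mem_set Uy)); exact: open_nbhs_nbhs.
Qed.

Lemma par_closed J U g h (a b : R) : hausdorff_space T ->
  parametrizes J U g h -> `[a, b]%classic `<=` J -> closed (g @` `[a, b]).
Proof.
move=> hT P abJ; apply: compact_closed => //; apply: continuous_compact.
  exact: continuous_subspaceW abJ (par_continuous P).
exact: segment_compact.
Qed.

(** The point q separates X into A and the rest, and is a limit of both.  The
set A may contain whole components of X: these conditions are local at q and
suffice to move q along an arc. *)
Record cut (A : set T) (q : T) : Prop := Cut {
  cut_open : exists2 W, open W & A = X `&` W ;
  cut_closed : closed (A `|` [set q]) ;
  cut_in : X q ;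
  cut_notin : ~ A q ;
  cut_inside : closure A q ;
  cut_outside : closure (X `\` (A `|` [set q])) q }.

(** A is relatively open in X, and relatively closed away from q, so that along
an arc avoiding q nothing changes. *)
Lemma cut_side A q (U : set T) g h (K : set R) : cut A q ->
  parametrizes `]-1, 1[ U g h -> connected K -> open K -> K `<=` `]-1, 1[ ->
  ~ K (h q) -> (X `&` U) q ->
  (forall t, K t -> A (g t)) \/ (forall t, K t -> ~ A (g t)).
Proof.
move=> cA P cK oK KJ Kq Uq; have [W oW AW] := cut_open cA.
have cg (t : R) : K t -> {for t, continuous g}.
  move=> Kt; have := par_continuous P.
  rewrite continuous_open_subspace; last exact: interval_open.
  by move=> cg; apply: cg; rewrite inE; exact: KJ.
have opre V : open V -> open (K `&` g @^-1` V).
  move=> oV; rewrite openE => t [Kt Vt]; apply: filterI.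
    exact: open_nbhs_nbhs.
  by apply: cg => //; exact: open_nbhs_nbhs.
pose B := K `&` g @^-1` A.
have [B0|B0] := pselect (B !=set0); last first.
  by right => t Kt At; apply: B0; exists t.
left; suff BK : B = K by move=> t; rewrite -BK => -[].
apply: cK => //.
- exists (K `&` g @^-1` W); first exact: opre.
  rewrite setIA setIid /B AW; apply/seteqP; split=> t /= [Kt].
    by case.
  by move=> Ot; split=> //; split=> //; case: (par_in P (KJ _ Kt)).
- exists (~` (K `&` g @^-1` (~` (A `|` [set q])))).
    by apply: open_closedC; apply: opre; apply: closed_openC; exact: cut_closed cA.
  apply/seteqP; split=> t /= [Kt H]; split=> //.
    by move=> [_]; apply; left.
  apply: contrapT => nA; apply: H; split=> // -[//|/= gq].
  by apply: Kq; rewrite -gq (parK P)//; exact: KJ.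
Qed.

Lemma par_near_right (U : set T) g h (t : R) (B : set T) :
  parametrizes `]-1, 1[ U g h -> `]-1, 1[%classic t -> nbhs (g t) B ->
  exists2 u, `]t, 1[%classic u & B (g u).
Proof.
move=> P tJ Bt; have := par_continuous P.
rewrite continuous_open_subspace; last exact: interval_open.
move=> /(_ t (mem_set tJ) _ Bt) nB.
have {}nB : \forall u \near t, B (g u) by exact: nB.
have t1 : t < 1 by move: tJ; rewrite /= in_itv /= => /andP[].
have /filter_ex [u [tu Bu]] : \forall u \near t^'+, `]t, 1[%classic u /\ B (g u).
  near=> u; split; last first.
    by near: u; exact: (cvg_within _ nB).
  rewrite /= in_itv /=; apply/andP; split; near: u.
    exact: nbhs_right_gt.
  exact: nbhs_right_lt.
by exists u.
Unshelve. all: by end_near. Qed.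

Lemma par_near_left (U : set T) g h (t : R) (B : set T) :
  parametrizes `]-1, 1[ U g h -> `]-1, 1[%classic t -> nbhs (g t) B ->
  exists2 u, `]-1, t[%classic u & B (g u).
Proof.
move=> P tJ Bt.
have oJ : `]-1, 1[%classic (- t).
  by move: tJ; rewrite /= !in_itv /= => /andP[? ?]; apply/andP; split; lra.
have [|u uJ Bu] := @par_near_right _ _ _ (- t) B (parametrizes_opp P) oJ.
  by rewrite opprK.
exists (- u) => //.
by move: uJ; rewrite /= !in_itv /= => /andP[? ?]; apply/andP; split; lra.
Qed.

(** Here A is the part of the arc to the left of q.  The new cutting point has
parameter 3/4: it lies in the arc, and beyond the middle half of the arc, which
is therefore swallowed. *)
Lemma cut_extend_right A q (U : set T) g h : hausdorff_space T -> cut A q ->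
  parametrizes `]-1, 1[ U g h -> U q -> `]-1/2, 1/2[%classic (h q) ->
  (forall t, `]-1, h q[%classic t -> A (g t)) ->
  (forall t, `]h q, 1[%classic t -> ~ A (g t)) ->
  exists A' q', [/\ cut A' q', A `<=` A' & X `&` U `&` h @^-1` `]-1/2, 1/2[ `<=` A'].
Proof.
move=> hT cA P Uq q12 lA rA; pose t : R := 3 / 4.
have Xq := cut_in cA.
have [q1 q2] : -1/2 < h q /\ h q < 1/2 by move: q12; rewrite /= in_itv /= => /andP[].
have tJ : `]-1, 1[%classic t by rewrite /= in_itv /= /t; apply/andP; split; lra.
have ltJ u : `]-1, t[%classic u -> `]-1, 1[%classic u.
  by rewrite /= !in_itv /= /t => /andP[? ?]; apply/andP; split; lra.
have rtJ u : `]t, 1[%classic u -> `]-1, 1[%classic u.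
  by rewrite /= !in_itv /= /t => /andP[? ?]; apply/andP; split; lra.
have grt u : `]t, 1[%classic u -> ~ (g @` `]-1, t[) (g u).
  move=> ut -[v vt] /(congr1 h); rewrite (parK P (ltJ _ vt)) (parK P (rtJ _ ut)).
  by move: ut vt; rewrite /= !in_itv /= => /andP[? ?] /andP[? ?]; lra.
have rAt u : `]t, 1[%classic u -> ~ A (g u).
  move=> ut; apply: rA; move: ut; rewrite /= !in_itv /= /t => /andP[? ?].
  by apply/andP; split; lra.
have gt : ~ (g @` `]-1, t[) (g t).
  move=> [v vt] /(congr1 h); rewrite (parK P (ltJ _ vt)) (parK P tJ).
  by move: vt; rewrite /= !in_itv /= => /andP[? ?]; lra.
exists (A `|` g @` `]-1, t[), (g t); split; first split.
- have [W oW AW] := cut_open cA.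
  exists (W `|` (U `&` h @^-1` `]-1, t[)).
    by apply: openU => //; apply: open_coord_preimage P _; exact: interval_open.
  rewrite setIUr -AW; congr (_ `|` _); apply/seteqP; split=> y.
    move=> [u ut <-]; have [Xu Uu] := par_in P (ltJ _ ut); split=> //; split=> //.
    by rewrite /= (parK P (ltJ _ ut)).
  move=> [Xy [Uy hy]]; exists (h y) => //.
  exact: (par_coordK P).
- have -> : A `|` g @` `]-1, t[ `|` [set g t] = A `|` [set q] `|` g @` `[h q, t].
    apply/seteqP; split=> y.
      move=> [[Ay|[u ut <-]]|->]; [by left; left| |]; last first.
        by right; exists t => //; rewrite /= in_itv /= lexx andbT /t; lra.
      have [uq|qu] := ltP u (h q).
        left; left; apply: lA; move: ut; rewrite /= !in_itv /= => /andP[-> _].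
        by rewrite uq.
      right; exists u => //; move: ut; rewrite /= !in_itv /= qu => /andP[_ /ltW].
      by [].
    move=> [[Ay|->]|[u ut <-]]; [by left; left| |].
      left; right; exists (h q); last by rewrite (par_coordK P).
      by rewrite /= in_itv /= /t; apply/andP; split; lra.
    have [->|ut'] := eqVneq u t; first by right.
    left; right; exists u => //; move: ut; rewrite /= !in_itv /= => /andP[? ?].
    by rewrite (lt_neqAle u) ut'; apply/andP; split => //; lra.
  apply: closedU; first exact: cut_closed cA.
  apply: (par_closed hT P) => u; rewrite /= !in_itv /= /t => /andP[? ?].
  by apply/andP; split; lra.
- by case: (par_in P tJ).
- by move=> [At|//]; apply: rA At; rewrite /= in_itv /= /t; apply/andP; split; lra.
- move=> B Bt; have [u ut Bu] := par_near_left P tJ Bt.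
  by exists (g u); split=> //; right; exists u.
- move=> B Bt; have [u ut Bu] := par_near_right P tJ Bt.
  exists (g u); split=> //; split; first by case: (par_in P (rtJ _ ut)).
  move=> [[Au|gu]|/= gut].
  + exact: (rAt u).
  + exact: (grt u).
  + have := parK P tJ; rewrite -gut (parK P (rtJ _ ut)) => e.
    by move: ut; rewrite /= in_itv /= e ltxx.
- by move=> y; left.
- move=> y [[Xy Uy] /= hy]; right; exists (h y); last by rewrite (par_coordK P).
  by move: hy; rewrite !in_itv /= /t => /andP[? ?]; apply/andP; split; lra.
Qed.

(** Each half of the arc is inside or outside of A.  Both cannot be outside,
since q is a limit of A, nor both inside, since q is a limit of the complement;
reversing the arc if necessary, A is on the left. *)
Lemma cut_extend A q (U : set T) g h : hausdorff_space T -> cut A q ->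
  parametrizes `]-1, 1[ U g h -> U q -> `]-1/2, 1/2[%classic (h q) ->
  exists A' q', [/\ cut A' q', A `<=` A' & X `&` U `&` h @^-1` `]-1/2, 1/2[ `<=` A'].
Proof.
move=> hT cA P Uq q12; have Xq := cut_in cA.
have [q1 q2] : -1/2 < h q /\ h q < 1/2 by move: q12; rewrite /= in_itv /= => /andP[].
have onbU : nbhs q U by apply: open_nbhs_nbhs; split => //; exact: par_open P.
have neq_side y : X y -> U y -> y <> q ->
    `]-1, h q[%classic (h y) \/ `]h q, 1[%classic (h y).
  move=> Xy Uy yq; have : `]-1, 1[%classic (h y) by exact: (par_coord P).
  rewrite /= !in_itv /= => /andP[y1 y2]; case: (ltgtP (h y) (h q)) => hyq.
  - by left; rewrite y1.
  - by right.
  - by case: yq; rewrite -(par_coordK P (conj Xy Uy)) hyq (par_coordK P).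
have sideP (K : set R) : connected K -> open K -> K `<=` `]-1, 1[ -> ~ K (h q) ->
    (forall t, K t -> A (g t)) \/ (forall t, K t -> ~ A (g t)).
  by move=> cK oK KJ Kq; exact: (cut_side cA P).
have [lA|lA] : (forall t, `]-1, h q[%classic t -> A (g t)) \/
               (forall t, `]-1, h q[%classic t -> ~ A (g t)).
- apply: sideP; [|exact: interval_open| |].
  + by apply/connected_intervalP; exact: interval_is_interval.
  + by move=> t; rewrite /= !in_itv /= => /andP[? ?]; apply/andP; split; lra.
  + by rewrite /= in_itv /= ltxx andbF.
- have [rA|rA] : (forall t, `]h q, 1[%classic t -> A (g t)) \/
                 (forall t, `]h q, 1[%classic t -> ~ A (g t)).
  + apply: sideP; [|exact: interval_open| |].
    * by apply/connected_intervalP; exact: interval_is_interval.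
    * by move=> t; rewrite /= !in_itv /= => /andP[? ?]; apply/andP; split; lra.
    * by rewrite /= in_itv /= ltxx.
  + exfalso; have [y [[Xy nA] Uy]] := cut_outside cA onbU.
    apply: nA; have [->|/eqP yq] := eqVneq y q; [by right|left].
    rewrite -(par_coordK P (conj Xy Uy)).
    by have [/lA|/rA] := neq_side _ Xy Uy yq.
  + exact: (cut_extend_right hT cA P).
- have [rA|rA] : (forall t, `]h q, 1[%classic t -> A (g t)) \/
                 (forall t, `]h q, 1[%classic t -> ~ A (g t)).
  + apply: sideP; [|exact: interval_open| |].
    * by apply/connected_intervalP; exact: interval_is_interval.
    * by move=> t; rewrite /= !in_itv /= => /andP[? ?]; apply/andP; split; lra.
    * by rewrite /= in_itv /= ltxx.
  + have [|||A' [q' [cA' AA' UA']]] := cut_extend_right hT cA (parametrizes_opp P) Uq.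
    * by rewrite /= in_itv /=; apply/andP; split; lra.
    * move=> t tq; apply: rA; move: tq; rewrite /= !in_itv /= => /andP[? ?].
      by apply/andP; split; lra.
    * move=> t tq; apply: lA; move: tq; rewrite /= !in_itv /= => /andP[? ?].
      by apply/andP; split; lra.
    exists A', q'; split=> // y [XUy hy]; apply: UA'; split=> //.
    by move: hy; rewrite /= !in_itv /= => /andP[? ?]; apply/andP; split; lra.
  + exfalso; have [W oW AW] := cut_open cA.
    have [y [Ay Uy]] := cut_inside cA onbU.
    have Xy : X y by move: Ay; rewrite AW => -[].
    have yq : y <> q by move=> yq; apply: (cut_notin cA); rewrite -yq.
    move: Ay; rewrite -(par_coordK P (conj Xy Uy)).
    by have [/lA|/rA] := neq_side _ Xy Uy yq.
Qed.

Lemma cut_half_arc (U : set T) g h : hausdorff_space T ->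
  parametrizes `[0, 1[ U g h -> exists A q, cut A q /\ A (g 0).
Proof.
move=> hT P; pose t : R := 1 / 2.
have J u : 0 <= u -> u < 1 -> `[0, 1[%classic u by rewrite /= in_itv /= => -> ->.
have tJ : `[0, 1[%classic t by apply: J; rewrite /t; lra.
have cg B : nbhs (g t) B -> \forall u \near t, B (g u).
  move=> nB; have : {within `]0, 1[, continuous g}.
    apply: continuous_subspaceW (par_continuous P) => u.
    by rewrite /= !in_itv /= => /andP[/ltW -> ->].
  rewrite continuous_open_subspace; last exact: interval_open.
  apply => //; rewrite inE /= in_itv /= /t; apply/andP; split; lra.
have ltJ u : `[0, t[%classic u -> `[0, 1[%classic u.
  by rewrite /= !in_itv /= /t => /andP[? ?]; apply/andP; split; lra.
have gt u : t <= u -> u < 1 -> ~ (g @` `[0, t[) (g u).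
  move=> tu u1 [v vt] /(congr1 h); rewrite (parK P (ltJ _ vt)) (parK P).
    by move: vt; rewrite /= !in_itv /= => /andP[? ?]; lra.
  by apply: J => //; move: tu; rewrite /t; lra.
exists (g @` `[0, t[), (g t); split; last first.
  by exists 0 => //; rewrite /= in_itv /= /t; apply/andP; split; lra.
split.
- exists (U `&` h @^-1` `]-1, t[).
    by apply: open_coord_preimage P _; exact: interval_open.
  apply/seteqP; split=> y.
    move=> [u ut <-]; have [Xu Uu] := par_in P (ltJ _ ut); split=> //; split=> //.
    rewrite /= (parK P (ltJ _ ut)); move: ut; rewrite /= !in_itv /= => /andP[? ?].
    by apply/andP; split; lra.
  move=> [Xy [Uy hy]]; exists (h y); last exact: (par_coordK P).
  have := par_coord P (conj Xy Uy); move: hy.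
  by rewrite /= !in_itv /= => /andP[_ ->] /andP[->].
- have -> : g @` `[0, t[ `|` [set g t] = g @` `[0, t].
    apply/seteqP; split=> y.
      move=> [[u ut <-]|->].
        by exists u => //; move: ut; rewrite /= !in_itv /= => /andP[-> /ltW].
      by exists t => //; rewrite /= in_itv /= lexx andbT /t; lra.
    move=> [u ut <-]; have [->|ut'] := eqVneq u t; first by right.
    left; exists u => //; move: ut; rewrite /= !in_itv /= => /andP[? ?].
    by rewrite (lt_neqAle u) ut'; apply/andP.
  apply: (par_closed hT P) => u; rewrite /= !in_itv /= /t => /andP[? ?].
  by apply/andP; split; lra.
- by case: (par_in P tJ).
- by apply: gt => //; rewrite /t; lra.
- move=> B /cg Bt.
  have /filter_ex [u [ut Bu]] : \forall u \near t^'-, `[0, t[%classic u /\ B (g u).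
    near=> u; split; last by near: u; exact: (cvg_within _ Bt).
    rewrite /= in_itv /=; apply/andP; split; near: u; last exact: nbhs_left_lt.
    by apply: nbhs_left_ge; rewrite /t; lra.
  by exists (g u); split=> //; exists u.
- move=> B /cg Bt.
  have /filter_ex [u [ut Bu]] : \forall u \near t^'+, `]t, 1[%classic u /\ B (g u).
    near=> u; split; last by near: u; exact: (cvg_within _ Bt).
    rewrite /= in_itv /=; apply/andP; split; near: u; first exact: nbhs_right_gt.
    by apply: nbhs_right_lt; rewrite /t; lra.
  move: ut; rewrite /= in_itv /= => /andP[tu u1].
  have uJ : `[0, 1[%classic u by apply: J => //; move: tu; rewrite /t; lra.
  exists (g u); split=> //; split; first by case: (par_in P uJ).
  move=> [|/= gut]; first by apply: gt => //; exact: ltW.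
  by have := parK P tJ; rewrite -gut (parK P uJ) => e; move: tu; rewrite e ltxx.
Unshelve. all: by end_near. Qed.

(** Start from a cut on the arc that begins at the end point g0 0, and cover the
rest of X by finitely many middle halves of open arcs.  As long as there is a
cut (A, q), the point q is in one of the middle halves not contained in A, and
[cut_extend] enlarges A so as to contain this one.  This cannot go on, the cover
being finite, but neither can it stop. *)
Lemma single_end_absurd (U0 : set T) g0 h0 : hausdorff_space T -> compact X ->
  parametrizes `[0, 1[ U0 g0 h0 ->
  (forall x, X x -> x <> g0 0 -> exists U g h,
     [/\ parametrizes `]-1, 1[ U g h, U x & h x = 0]) -> False.
Proof.
move=> hT cX P0 arcs; have [A0 [q0 [cA0 A0p]]] := cut_half_arc hT P0.
have [W oW AW] := cut_open cA0.
(* T with a base point, which [compact_cover] asks for *)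
pose pT : ptopologicalType := HB.pack T (isPointed.Build T q0).
pose small x (V : set T) := exists U g h, [/\ parametrizes `]-1, 1[ U g h,
   U x, h x = 0 & V = U `&` h @^-1` `]-1/2, 1/2[].
have /choice [V VP] : forall x, exists V, X x -> ~ A0 x -> small x V.
  move=> x; have [[Xx nA]|nX] := pselect (X x /\ ~ A0 x); last first.
    by exists setT => Xx nA; case: nX.
  have [|U [g [h [P Ux hx]]]] := arcs x Xx; first by move=> xe; apply: nA; rewrite xe.
  by exists (U `&` h @^-1` `]-1/2, 1/2[) => _ _; exists U, g, h.
have cXA : compact (X `\` A0).
  have -> : X `\` A0 = X `&` ~` W.
    apply/seteqP; split=> x [Xx nA]; split=> //.
      by move=> Ox; apply: nA; rewrite AW.
    by rewrite AW => -[].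
  by apply: compact_closedI => //; exact: open_closedC.
have ccXA : @cover_compact pT (X `\` A0) by rewrite -compact_cover.
have [D DX Dcov] : finite_subset_cover (X `\` A0) V (X `\` A0).
  apply: (ccXA) => [x [Xx nA]|x [Xx nA]].
    have [U [g [h [P _ _ ->]]]] := VP x Xx nA.
    by apply: open_coord_preimage P _; exact: interval_open.
  exists x => //; have [U [g [h [P Ux hx ->]]]] := VP x Xx nA.
  by split=> //; rewrite /= hx in_itv /=; apply/andP; split; lra.
(* s indexes members of the cover which together contain the complement of A *)
suff H (s : seq T) A q : (forall i, i \in s -> X i /\ ~ A0 i) ->
    cut A q -> (forall y, X y -> ~ A y -> exists2 i, i \in s & V i y) -> False.
  apply: (H (finmap.enum_fset D) A0 q0) => // [i iD|y Xy nA].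
    by have /set_mem := DX _ iD.
  by have [i iD Vy] := Dcov y (conj Xy nA); exists i.
have [m sm] := ubnP (size s); elim: m s sm A q => // m IH s sm A q sX cA cov.
have [i si Vq] := cov q (cut_in cA) (cut_notin cA).
have [Xi nAi] := sX i si.
have [U [g [h [P Ui hi Vi]]]] := VP i Xi nAi.
have [Uq hq] : U q /\ `]-1/2, 1/2[%classic (h q) by move: Vq; rewrite Vi.
have [A' [q' [cA' AA' UA']]] := cut_extend hT cA P Uq hq.
have sm' : (size (rem i s) < m)%N.
  by rewrite size_rem//; move: sm si; case: s {sX cov} => //= *; lia.
apply: (IH _ sm' A' q' _ cA') => [j js|y Xy nA]; first by apply: sX; exact: mem_rem js.
have [j js Vj] := cov y Xy (fun Ay => nA (AA' _ Ay)).
exists j => //; have [ji|ji] := eqVneq j i.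
  by exfalso; apply: nA; apply: UA'; move: Vj; rewrite ji Vi => -[? ?].
have := js; rewrite (perm_mem (perm_to_rem si)) inE => /orP[/eqP ij|//].
by move: ji; rewrite ij eqxx.
Qed.

End OneManifold.

(** * Strict derivatives *)

Lemma nbhs_dist (R : realFieldType) (V : pseudoMetricNormedZmodType R) (x : V)
    (P : set V) :
  nbhs x P <-> exists2 r : R, 0 < r & forall y, `|y - x| < r -> P y.
Proof.
apply: (iff_trans (nbhs_ballP x P)); split=> -[r r0 H]; exists r => // y.
  by move=> xy; apply: H; rewrite -ball_normE /= distrC.
by rewrite -ball_normE /= distrC; exact: H.
Qed.

Section RowNorm.
Context {R : realType}.

Lemma norm_coord_le n (x : 'rV[R]_n) j : `|x 0 j| <= `|x|.
Proof.
rewrite [leRHS]/Num.norm /= mx_normrE.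
by rewrite (le_bigmax _ (fun ij : 'I_1 * 'I_n => `|x ij.1 ij.2|) (0, j)).
Qed.

Lemma norm_row_le n (x : 'rV[R]_n) (c : R) :
  0 <= c -> (forall j, `|x 0 j| <= c) -> `|x| <= c.
Proof.
move=> c0 H; rewrite [leLHS]/Num.norm /= mx_normrE.
by apply: bigmax_le => // -[i j] _ /=; rewrite ord1.
Qed.

Lemma norm_row_lt n (x : 'rV[R]_n) (c : R) :
  0 < c -> (forall j, `|x 0 j| < c) -> `|x| < c.
Proof.
move=> c0 H; rewrite [ltLHS]/Num.norm /= mx_normrE.
by apply: bigmax_lt => // -[i j] _ /=; rewrite ord1.
Qed.

Lemma norm_mulmx_le m n (D : 'M[R]_(m, n)) :
  exists2 K : R, 0 < K & forall x : 'rV[R]_m, `|x *m D| <= K * `|x|.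
Proof.
pose K := \sum_i `|row i D|; have K0 : 0 <= K by apply: sumr_ge0 => i _.
exists (K + 1); first exact: ltr_wpDl.
move=> x; rewrite mulmx_sum_row; apply: le_trans (ler_norm_sum _ _ _) _.
rewrite mulrDl mul1r -[leLHS]addr0; apply: lerD => //.
rewrite /K mulr_suml; apply: ler_sum => i _.
by rewrite normrZ mulrC ler_wpM2l// norm_coord_le.
Qed.

End RowNorm.

Section StrictDerivative.
Context {R : realType}.

Definition lin_approx m n (A : set 'rV[R]_m) (f : 'rV[R]_m -> 'rV[R]_n)
    (D : 'M[R]_(m, n)) (e : R) : Prop :=
  forall a b, A a -> A b -> `|f a - f b - (a - b) *m D| <= e * `|a - b|.

(** Strict differentiability compares f at two points near x, both of them
moving.  Functions of class C^1 have this property, up to the boundary of their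
domain, and it is what local inversion requires: a Lipschitz bound for f - D. *)
Definition strict_diff m n (A : set 'rV[R]_m) (f : 'rV[R]_m -> 'rV[R]_n)
    (x : 'rV[R]_m) (D : 'M[R]_(m, n)) : Prop :=
  forall e : R, 0 < e -> exists2 r : R, 0 < r &
    lin_approx (A `&` [set a | `|a - x| < r]) f D e.

Lemma strict_diff_within m n (A : set 'rV[R]_m) (f : _ -> 'rV[R]_n) x D :
  A x -> strict_diff A f x D -> diff_within A f x D.
Proof.
move=> Ax sD e /sD[r r0 H]; apply: (proj2 (nbhs_dist _ _)).
by exists r => // y xy Ay; apply: H; split=> //=; rewrite subrr normr0.
Qed.

Lemma strict_diff_id m (A : set 'rV[R]_m) x : strict_diff A id x 1%:M.
Proof.
move=> e e0; exists 1 => // a b _ _.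
by rewrite mulmx1 subrr normr0 mulr_ge0// ltW.
Qed.

Lemma strict_diff_local m n (A B : set 'rV[R]_m) (f g : _ -> 'rV[R]_n) x D r :
  0 < r -> (forall a, B a -> `|a - x| < r -> A a /\ g a = f a) ->
  strict_diff A f x D -> strict_diff B g x D.
Proof.
move=> r0 BA sD e /sD[r' r'0 H]; exists (Num.min r r'); first by rewrite lt_min r0.
move=> a b [Ba /=]; rewrite lt_min => /andP[ar ar'] [Bb /=].
rewrite lt_min => /andP[br br'].
have [Aa ->] := BA a Ba ar; have [Ab ->] := BA b Bb br.
exact: H.
Qed.

Lemma strict_diff_lipschitz m n (A : set 'rV[R]_m) (f : _ -> 'rV[R]_n) x D :
  strict_diff A f x D -> exists r K : R, [/\ 0 < r, 0 < K &
    forall a b, A a -> `|a - x| < r -> A b -> `|b - x| < r ->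
      `|f a - f b| <= K * `|a - b|].
Proof.
move=> /(_ 1 ltr01)[r r0 H]; have [K K0 HK] := norm_mulmx_le D.
exists r, (1 + K); split=> //; first exact: addr_gt0.
move=> a b Aa ar Ab br; rewrite -[f a - f b](subrK ((a - b) *m D)).
by apply: le_trans (ler_normD _ _) _; rewrite mulrDl; apply: lerD => //; exact: H.
Qed.

Lemma strict_diff_comp m n p (A : set 'rV[R]_m) (B : set 'rV[R]_n)
    (f : _ -> 'rV[R]_n) (g : _ -> 'rV[R]_p) x D D' (r : R) :
  A x -> 0 < r -> (forall a, A a -> `|a - x| < r -> B (f a)) ->
  strict_diff A f x D -> strict_diff B g (f x) D' ->
  strict_diff A (g \o f) x (D *m D').
Proof.
move=> Ax r0 AB sD sD' e e0.
have [r1 [K [r1_gt0 K0 HK]]] := strict_diff_lipschitz sD.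
have [K' K'0 HK'] := norm_mulmx_le D'.
have [r2 r20 H2] : exists2 r2 : R, 0 < r2 &
    lin_approx (A `&` [set a | `|a - x| < r2]) f D (e / 2 / K').
  by apply: sD; rewrite !divr_gt0.
have [r3 r30 H3] : exists2 r3 : R, 0 < r3 &
    lin_approx (B `&` [set a | `|a - f x| < r3]) g D' (e / 2 / K).
  by apply: sD'; rewrite !divr_gt0.
exists (Num.min (Num.min r r1) (Num.min r2 (r3 / K))).
  by rewrite !lt_min r0 r1_gt0 r20 divr_gt0.
have near_fx a : A a -> `|a - x| < r1 -> `|a - x| < r3 / K -> `|f a - f x| < r3.
  move=> Aa ar1 ar3; apply: le_lt_trans (HK a x Aa ar1 Ax _) _.
    by rewrite subrr normr0.
  by rewrite mulrC -ltr_pdivlMr.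
move=> a b [Aa /=]; rewrite !lt_min => /andP[/andP[ar ar1] /andP[ar2 ar3]].
move=> [Ab /=] /andP[/andP[br br1] /andP[br2 br3]].
have -> : g (f a) - g (f b) - (a - b) *m (D *m D') =
    (g (f a) - g (f b) - (f a - f b) *m D') + (f a - f b - (a - b) *m D) *m D'.
  by rewrite (mulmxBl (f a - f b)) -mulmxA addrA subrK.
apply: le_trans (ler_normD _ _) _; rewrite [leRHS](_ : _ =
  e / 2 / K * (K * `|a - b|) + K' * (e / 2 / K' * `|a - b|)); last first.
  by field; rewrite !gt_eqF.
apply: lerD.
  apply: (le_trans (y := e / 2 / K * `|f a - f b|)).
    by apply: H3; split; [exact: AB|exact: near_fx|exact: AB|exact: near_fx].
  by apply: ler_wpM2l; [rewrite ltW// !divr_gt0|exact: HK].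
apply: le_trans (HK' _) _; apply: ler_wpM2l; first exact: ltW.
by apply: H2; split.
Qed.

(** The derivative D' at w is within e of any D that approximates f near w up to
e.  Only points w + t *: v with t > 0 are compared with w, so that w may be a
boundary point and v an inward direction. *)
Lemma strict_diff_dist m n (A A' : set 'rV[R]_m) (f : _ -> 'rV[R]_n) D D' w
    (v : 'rV[R]_m) (e : R) :
  lin_approx A' f D e -> strict_diff A f w D' -> A w -> A' w ->
  (\forall t \near (0 : R)^'+, A (w + t *: v) /\ A' (w + t *: v)) ->
  `|v *m (D - D')| <= e * `|v|.
Proof.
move=> HD sD' Aw A'w nA.
have [->|v0] := eqVneq v 0; first by rewrite mul0mx !normr0 mulr0.
have nv : 0 < `|v| by rewrite normr_gt0.
rewrite -ler_pdivrMr//; apply/ler_addgt0Pr => e' e'0.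
rewrite ler_pdivrMr// mulrDl; have [r r0 Hr] := sD' _ e'0.
have /filter_ex [t [[t0 tr] [At A't]]] : \forall t \near (0 : R)^'+,
    (0 < t /\ t < r / `|v|) /\ (A (w + t *: v) /\ A' (w + t *: v)).
  near=> t; split; last by near: t.
  split; near: t; first exact: nbhs_right_gt.
  by apply: nbhs_right_lt; rewrite divr_gt0.
have wtv : w + t *: v - w = t *: v by rewrite addrAC subrr add0r.
have ntv : `|t *: v| = t * `|v| by rewrite normrZ gtr0_norm.
rewrite -(ler_pM2l t0) mulrDr !(mulrCA t) -ntv.
have -> : t * `|v *m (D - D')| = `|(t *: v) *m (D - D')|.
  by rewrite -scalemxAl normrZ gtr0_norm.
have -> : (t *: v) *m (D - D') =
    (f (w + t *: v) - f w - (t *: v) *m D') - (f (w + t *: v) - f w - (t *: v) *m D).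
  by rewrite mulmxBr opprB [RHS]addrC addrA subrK.
have := HD _ _ A't A'w; rewrite wtv => HDt.
have := Hr (w + t *: v) w; rewrite wtv => Hrt.
apply: le_trans (ler_normB _ _) _; rewrite [leLHS]addrC; apply: lerD => //.
apply: Hrt; split=> //=; last by rewrite subrr normr0.
by rewrite wtv ntv -ltr_pdivlMr.
Unshelve. all: by end_near. Qed.

Lemma directional_mvt m n (f : 'rV[R]_m -> 'rV[R]_n) (z v : 'rV[R]_m) (h e : R)
    (d : 'rV[R]_n) : 0 <= h ->
  (forall t, 0 <= t <= h -> derivable f (z + t *: v) v) ->
  (forall t, 0 <= t <= h -> `|'D_v f (z + t *: v) - d| <= e) ->
  `|f (z + h *: v) - f z - h *: d| <= e * h.
Proof.
move=> h0 fD fe.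
have e0 : 0 <= e by apply: le_trans (fe 0 _); rewrite ?lexx.
apply: norm_row_le => [|j]; first exact: mulr_ge0.
pose phi t := f (z + t *: v) 0 j.
have phiD t : 0 <= t <= h -> is_derive t 1 phi (('D_v f (z + t *: v)) 0 j).
  move=> th; have /(is_derive_coord_of j) fj := DeriveDef (fD t th) erefl.
  apply: is_derive_cvg; have [+ fjE] := fj; rewrite -fjE.
  move=> /cvg_ex[l Hl]; have -> : 'D_v (fun y => f y 0 j) (z + t *: v) = l.
    exact: cvg_lim Hl.
  apply: cvg_trans Hl; apply: near_eq_cvg; near=> s; rewrite /phi /=.
  by congr (_ *: (f _ 0 j - _)); rewrite [s *: 1]mulr1 scalerDl addrCA.
have phiI t : t \in `[0, h] -> is_derive t 1 phi (('D_v f (z + t *: v)) 0 j).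
  by rewrite in_itv /= => /phiD.
have [c] := MVT_segment h0 (fun t tI => phiI t (subset_itv_oo_cc tI))
  (derivable_within_continuous (fun t tI => let: DeriveDef H _ := phiI t tI in H)).
rewrite in_itv /= subr0 => /fe fc; rewrite /phi scale0r addr0 => phiE.
rewrite !mxE phiE -[h * d 0 j]mulrC -mulrBl normrM (ger0_norm h0).
apply: ler_wpM2r => //; apply: le_trans fc.
by have := norm_coord_le ('D_v f (z + c *: v) - d) j; rewrite !mxE.
Unshelve. all: by end_near. Qed.

(** Go from b to a by changing one coordinate at a time.  The balls of the sup
norm are boxes, so the path stays in the ball, and each step is controlled by
the continuity at x of one partial derivative. *)
Lemma Ck_strict_diff m n (U : set 'rV[R]_m) (f : 'rV[R]_m -> 'rV[R]_n) x :
  open U -> U x -> Ck U 1 f -> exists D, strict_diff U f x D.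
Proof.
move=> oU Ux [_ fD]; exists (\matrix_i 'D_('e_i) f x) => e e0.
pose e' := e / m.+1%:R; have e'0 : 0 < e' by rewrite divr_gt0.
have : \forall y \near x, U y /\ forall i : 'I_m,
    `|'D_('e_i) f y - 'D_('e_i) f x| <= e'.
  apply: filterI; first exact: open_nbhs_nbhs.
  apply: (@filter_forall _ 'I_m
    (fun i y => `|'D_('e_i) f y - 'D_('e_i) f x| <= e') _ (nbhs_filter x)).
  move=> i; have [_ [Dc _]] := fD 'e_i.
  have /cvgrPdistC_le Dx := Dc x Ux.
  exact: Dx.
move=> /nbhs_dist[r r0 Hr]; exists r => // a b [_ ar] [_ br].
pose z k : 'rV[R]_m := \row_(j < m) (if (j < k)%N then a 0 j else b 0 j).
have zx k : `|z k - x| < r.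
  apply: norm_row_lt => // j; rewrite !mxE; case: ifP => _.
    by have := norm_coord_le (a - x) j; rewrite !mxE => /le_lt_trans; exact.
  by have := norm_coord_le (b - x) j; rewrite !mxE => /le_lt_trans; exact.
have z0 : z 0 = b by apply/rowP => j; rewrite mxE.
have zm : z m = a by apply/rowP => j; rewrite mxE ltn_ord.
have zS (i : 'I_m) : z i.+1 = z i + (a 0 i - b 0 i) *: 'e_i.
  apply/rowP => j; rewrite !mxE eqxx /= ltnS leq_eqVlt.
  have [/val_inj ->|ji] /= := eqVneq (val j) (val i).
    by rewrite ltnn eqxx mulr1 addrC subrK.
  rewrite (_ : (j == i) = false) ?mulr0 ?addr0//.
  by apply/negbTE; apply: contra ji => /eqP ->.
have seg w (i : 'I_m) (h t : R) : `|w - x| < r -> `|w + h *: 'e_i - x| < r ->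
    0 <= t <= h -> `|w + t *: 'e_i - x| < r.
  move=> wr hr /andP[t0 th]; apply: norm_row_lt => // j.
  have := le_lt_trans (norm_coord_le _ j) wr.
  have := le_lt_trans (norm_coord_le _ j) hr.
  rewrite !mxE eqxx /=; case: (j == i); rewrite ?mulr1 ?mulr0 ?addr0//.
  by rewrite !ltr_norml => /andP[? ?] /andP[? ?]; apply/andP; split; lra.
(* a step in the negative direction is a positive step read backwards *)
have step w (i : 'I_m) (h : R) : 0 <= h -> `|w - x| < r ->
    `|w + h *: 'e_i - x| < r ->
    `|f (w + h *: 'e_i) - f w - h *: 'D_('e_i) f x| <= e' * h.
  move=> h0 wr hr; apply: directional_mvt => // t th; last first.
    exact: (Hr _ (seg _ _ _ _ wr hr th)).2.
  by apply: (fD 'e_i).1; exact: (Hr _ (seg _ _ _ _ wr hr th)).1.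
have := @telescope_sumr _ 0%N m (f \o z) (leq0n m).
rewrite /= z0 zm big_mkord => <-; rewrite mulmx_sum_row -sumrB.
apply: le_trans (ler_norm_sum _ _ _) _.
apply: (@le_trans _ _ (\sum_(i < m) e' * `|a - b|)).
  apply: ler_sum => i _; rewrite rowK.
  apply: (@le_trans _ _ (e' * `|(a - b) 0 i|)); last first.
    by rewrite ler_pM2l// norm_coord_le.
  have ziS := zS i; have ziS' := zx i.+1; move: ziS ziS'; rewrite !mxE.
  set h := a 0 i - b 0 i => -> ziS'.
  have [h0|h0] := leP 0 h; first by rewrite (ger0_norm h0); exact: step (zx i) ziS'.
  rewrite ltr0_norm//; have h0' : 0 <= - h by rewrite oppr_ge0 ltW.
  have := step (z i + h *: 'e_i) i (- h) h0' ziS'.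
  rewrite scaleNr addrK => /(_ (zx i)); rewrite -normrN scaleNr opprK opprD opprB.
  by [].
rewrite sumr_const card_ord -mulr_natl mulrA ler_wpM2r//.
rewrite /e' mulrCA; apply: ler_piMr; first exact: ltW.
by rewrite ler_pdivrMr// mul1r ler_nat.
Qed.

Lemma smooth_strict_diff m n (A : set 'rV[R]_m) (f : 'rV[R]_m -> 'rV[R]_n) x :
  smooth_on A f -> A x -> exists D, strict_diff A f x D.
Proof.
move=> fA Ax; have [W [g [oW Wx gC fg]]] := fA x Ax.
have [D gD] := Ck_strict_diff oW Wx (gC 1%N); exists D.
have /nbhs_dist [r r0 Hr] := open_nbhs_nbhs (conj oW Wx).
apply: (strict_diff_local r0 _ gD) => a Aa /Hr Wa; split=> //.
exact: fg.
Qed.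

End StrictDerivative.

(** * The fixed curve of an involution whose differential fixes a line *)

HB.instance Definition _ (R : realType) m n := Complete.on 'M[R]_(m, n).

Section LinearInvolution.
Context {R : realType}.

(** If P = C B is a full rank factorization of an idempotent, then B C = 1, and
the traces of C B and B C agree. *)
Lemma mxtrace_idempotent n (P : 'M[R]_n) : P *m P = P -> \tr P = (\rank P)%:R.
Proof.
move=> PP; have := mulmx_base P.
have /row_freeP [B' BB'] := row_base_free P.
have /row_fullP [C' C'C] := col_base_full P.
move: (col_base P) (row_base P) BB' C'C => C B BB' C'C CB.
have BC : B *m C = 1%:M.
  have : C *m (B *m C) *m B = C *m B by rewrite mulmxA CB -mulmxA CB PP.
  move=> /(congr1 (fun M => C' *m M *m B')).
  by rewrite /= !mulmxA C'C mul1mx -!mulmxA BB' mulmx1.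
by rewrite -{1}CB mxtrace_mulC BC mxtrace1.
Qed.

Definition plus_proj n (L : 'M[R]_n) : 'M[R]_n := 2^-1 *: (1%:M + L).

Lemma plus_proj_idem n (L : 'M[R]_n) :
  L *m L = 1%:M -> plus_proj L *m plus_proj L = plus_proj L.
Proof.
move=> LL; rewrite /plus_proj -scalemxAl -scalemxAr scalerA mulmxDl !mulmxDr.
rewrite LL !mul1mx mulmx1 [L + _]addrC -mulr2n -[(_ + _) *+ 2]scaler_nat scalerA.
by congr (_ *: _); field.
Qed.

(** The projection (1 + L) / 2 onto the fixed space of L is idempotent; the
natural number r is its rank. *)
Lemma involution_trace n (L : 'M[R]_n) : L *m L = 1%:M ->
  exists r : nat, \tr L = 2 * r%:R - n%:R.
Proof.
move=> LL; exists (\rank (plus_proj L)).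
rewrite -mxtrace_idempotent ?plus_proj_idem// /plus_proj linearZ /= linearD /=.
by rewrite mxtrace1; field.
Qed.

Lemma idempotent_line n (P : 'M[R]_n) : P *m P = P -> \tr P = 1 ->
  exists (l : 'cV[R]_n) (e : 'rV[R]_n), e *m l = 1%:M /\ l *m e = P.
Proof.
move=> PP trP.
have rP : \rank P = 1%N.
  by apply/eqP; rewrite -(eqr_nat R) -mxtrace_idempotent// trP.
have [l [e leP]] : exists (l : 'cV[R]_n) (e : 'rV[R]_n), l *m e = P.
  move: (col_base P) (row_base P) (mulmx_base P); rewrite rP => l e leP.
  by exists l, e.
exists l, e; split=> //.
have : \tr (e *m l) = 1 by rewrite mxtrace_mulC leP.
by rewrite /mxtrace big_ord1 => el; apply/matrixP => i j; rewrite !ord1 el mxE.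
Qed.

(** The fixed space of L is the line spanned by e, and l is the linear form which
is 1 on e and 0 on the (-1)-eigenspace. *)
Lemma involution_line n (L : 'M[R]_n) : L *m L = 1%:M -> \tr L = 2 - n%:R ->
  exists (l : 'cV[R]_n) (e : 'rV[R]_n),
    e *m l = 1%:M /\ L = 2 *: (l *m e) - 1%:M.
Proof.
move=> LL trL; have [|l [e [el leP]]] := idempotent_line (plus_proj_idem LL).
  by rewrite /plus_proj linearZ /= linearD /= mxtrace1 trL; field.
exists l, e; split=> //; rewrite leP /plus_proj scalerA divff ?scale1r ?pnatr_eq0//.
by rewrite addrAC subrr add0r.
Qed.

End LinearInvolution.

Section FixedCurve.
Context {R : realType}.

Definition axis n (l : 'cV[R]_n) (v : 'rV[R]_n) : R := (v *m l) 0 0.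

Lemma axisB n (l : 'cV[R]_n) v w : axis l (v - w) = axis l v - axis l w.
Proof. by rewrite /axis mulmxBl !mxE. Qed.

Lemma axis_continuous n (l : 'cV[R]_n) : continuous (axis l).
Proof.
move=> x; have [K K0 HK] := norm_mulmx_le l.
apply/(@cvgrPdistC_le _ _ _ _ (nbhs_filter x)) => e e0.
apply: (proj2 (nbhs_dist _ _)); exists (e / K); first exact: divr_gt0.
move=> y xy; rewrite /= -axisB; apply: le_trans (norm_coord_le _ 0) _.
by apply: le_trans (HK _) _; rewrite mulrC -ler_pdivlMr// ltW.
Qed.

Lemma axisD n (l : 'cV[R]_n) v w : axis l (v + w) = axis l v + axis l w.
Proof. by rewrite /axis mulmxDl !mxE. Qed.

Lemma axisZ n (l : 'cV[R]_n) a v : axis l (a *: v) = a * axis l v.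
Proof. by rewrite /axis -scalemxAl !mxE. Qed.

Lemma axisE n (l : 'cV[R]_n) (e v : 'rV[R]_n) : v *m (l *m e) = axis l v *: e.
Proof.
by rewrite mulmxA [v *m l]mx11_scalar mul_scalar_mx.
Qed.

Lemma banach_row n (U : set 'rV[R]_n) (T : 'rV[R]_n -> 'rV[R]_n) (q : R) :
  closed U -> U !=set0 -> (forall x, U x -> U (T x)) -> 0 <= q -> q < 1 ->
  (forall x y, U x -> U y -> `|T x - T y| <= q * `|x - y|) ->
  exists2 x, U x & x = T x.
Proof.
move=> cU U0 TU q0 q1 Tq.
apply: (@banach_fixed_point R 'rV[R]_n U (mkfun TU)) => //.
exists (NngNum q0); split=> //= -[x y] [Ux Uy]; exact: Tq.
Qed.

Variables (n : nat) (f : 'rV[R]_n -> 'rV[R]_n) (D : set 'rV[R]_n).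
Variables (x0 : 'rV[R]_n) (l : 'cV[R]_n) (e : 'rV[R]_n) (S : set R) (r0 : R).
Let L : 'M[R]_n := 2 *: (l *m e) - 1%:M.
Hypothesis el : e *m l = 1%:M.
Hypothesis sD : strict_diff D f x0 L.
Hypothesis r0_gt0 : 0 < r0.
Hypothesis DS : forall x, `|x - x0| < r0 -> (D x <-> S (axis l (x - x0))).
Hypothesis Df : forall x, D x -> `|x - x0| < r0 -> D (f x) /\ f (f x) = x.
Hypothesis Dx0 : D x0.
Hypothesis fx0 : f x0 = x0.

Lemma mulmxL v : v *m L = 2 * axis l v *: e - v.
Proof. by rewrite mulmxBr mulmx1 -scalemxAr axisE scalerA. Qed.

Lemma axis_e : axis l e = 1.
Proof. by rewrite /axis el mxE. Qed.

(** The fixed points of f near x0 are parametrized by their component [axis l]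
along the fixed line e of the differential L of f at x0.

For two fixed points x and y, the difference v = x - y is almost fixed by L, so
that its component v *m Q in the (-1)-eigenspace is small: this is the Lipschitz
bound.  To find the fixed point with component s, solve first
(f x - x) *m Q = 0.  On the slice [axis l (x - x0) = s] the differential of
f x - x is -2, which makes x + (f x - x) *m Q / 2 a contraction.  Its fixed
point x satisfies f x = x + u with u a multiple of e.  Now
f (f x) - f x = x - f x = - u, but f (x + u) - f x is close to u *m L = u,
whence u = 0.

The set S is R if x0 is an interior point of the domain D of f, and a half-line
if D is a half-space bounded by a (-1)-eigenspace: in both cases D contains the
slices with s in S near x0. *)
Lemma fixed_curve rho : 0 < rho -> exists (r d C : R),
  [/\ 0 < r, r <= rho, 0 < d, 0 < C &
   (forall x y, D x -> D y -> `|x - x0| < r -> `|y - x0| < r ->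
      f x = x -> f y = y -> `|x - y| <= C * `|axis l (x - y)|) /\
   (forall s, S s -> `|s| < d -> exists x,
      [/\ D x, `|x - x0| < r, f x = x & axis l (x - x0) = s])].
Proof.
move=> rho0.
pose Q : 'M[R]_n := 1%:M - l *m e.
have QE v : v *m Q = v - axis l v *: e by rewrite mulmxBr mulmx1 axisE.
have axisQ v : axis l (v *m Q) = 0.
  by rewrite QE axisB axisZ axis_e mulr1 subrr.
have [K K0 HK] := norm_mulmx_le Q.
have [K' K'0 HK'] := norm_mulmx_le L.
(* eps makes the contraction factor eps * K / 2 of T at most 1/4 *)
pose eps : R := (2 * (1 + K))^-1.
have eps0 : 0 < eps by rewrite invr_gt0 mulr_gt0// addr_gt0.
have epsK : eps * K <= 2^-1.
  rewrite /eps invfM -mulrA ler_piMr// mulrC ler_pdivrMr ?mul1r ?lerDr//.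
  exact: addr_gt0.
have eps2 : eps <= 2^-1.
  by rewrite /eps lef_pV2 ?posrE ?mulr_gt0 ?addr_gt0//; lra.
have [r1 r1_gt0 H1] := sD eps0.
pose r := Num.min rho (Num.min r0 r1).
have r_gt0 : 0 < r by rewrite !lt_min rho0 r0_gt0.
have rr0 (x : 'rV[R]_n) : `|x| < r -> `|x| < r0 by rewrite !lt_min => /and3P[].
have rr1 (x : 'rV[R]_n) : `|x| < r -> `|x| < r1 by rewrite !lt_min => /and3P[].
have Hr x y : D x -> D y -> `|x - x0| < r -> `|y - x0| < r ->
    `|f x - f y - (x - y) *m L| <= eps * `|x - y|.
  by move=> Dx Dy xr yr; apply: H1; split=> //=; exact: rr1.
have ne0 : 0 <= `|e| by [].
(* f maps the ball of radius rho' into the one of radius r, as K' bounds L *)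
exists r; pose rho' := r / (K' + 2).
have K'2 : 0 < K' + 2 by rewrite addr_gt0.
have rho'0 : 0 < rho' by rewrite divr_gt0.
have rho'r : rho' < r.
  by rewrite /rho' ltr_pdivrMr// ltr_pMr//; lra.
pose d := rho' / (4 * (`|e| + 1)).
have d0 : 0 < d by rewrite divr_gt0// mulr_gt0//; lra.
exists d, (2 * `|e| + 1); split=> //.
  by rewrite /r ge_min lexx.
split=> [x y Dx Dy xr yr fx fy|s Ss sd].
  set v := x - y; have := Hr x y Dx Dy xr yr; rewrite fx fy -/v mulmxL => Hv.
  have E : v = 2^-1 *: (v - (2 * axis l v *: e - v)) + axis l v *: e.
    by apply/rowP => j; rewrite !mxE; field.
  have : `|v| <= 2^-1 * (eps * `|v|) + `|axis l v| * `|e|.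
    rewrite {1}E; apply: le_trans (ler_normD _ _) _; rewrite !normrZ.
    by apply: lerD => //; rewrite gtr0_norm// ler_wpM2l.
  have : eps * `|v| <= 2^-1 * `|v| by rewrite ler_wpM2r.
  have : 0 <= `|v| by []; have : 0 <= `|axis l v| by [].
  by move: `|v| `|axis l v| (eps * `|v|) => a b c; nra.
pose T x := x + 2^-1 *: ((f x - x) *m Q).
pose U := [set x | `|x - x0| <= rho' /\ axis l (x - x0) = s].
have Ur x : U x -> `|x - x0| < r by move=> [xr _]; exact: le_lt_trans rho'r.
have UD x : U x -> D x.
  by move=> Ux; apply: (DS (rr0 _ (Ur x Ux))).2; case: Ux => _ ->.
have TT x y : U x -> U y -> `|T x - T y| <= 4^-1 * `|x - y|.
  move=> Ux Uy; have := Hr x y (UD x Ux) (UD y Uy) (Ur x Ux) (Ur y Uy).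
  set o := f x - f y - _ => Ho.
  have xy0 : axis l (x - y) = 0.
    have := Ux.2; have := Uy.2; rewrite !axisB => e1 e2.
    by move: e1 e2; lra.
  have -> : T x - T y = 2^-1 *: (o *m Q).
    have xyQ : x *m Q - y *m Q = x - y.
      by rewrite -mulmxBl QE xy0 scale0r subr0.
    rewrite /o mulmxL xy0 mulr0 scale0r sub0r opprK /T !(mulmxBl, mulmxDl).
    move: (x *m Q) (y *m Q) (f x *m Q) (f y *m Q) xyQ => xQ yQ a b xyQ.
    apply/rowP => j; have := congr1 (fun v : 'rV_n => v 0 j) xyQ.
    by rewrite !mxE; lra.
  rewrite normrZ gtr0_norm//; have := HK o.
  have : K * `|o| <= K * (eps * `|x - y|) by rewrite ler_wpM2l// ltW.
  have : K * eps * `|x - y| <= 2^-1 * `|x - y| by rewrite ler_wpM2r// mulrC.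
  by rewrite mulrA; move: (K * `|o|) (K * eps * `|x - y|) `|o *m Q| `|x - y| => *; lra.
have nse : `|s| * `|e| <= rho' / 4.
  have : `|s| * (`|e| + 1) <= rho' / 4.
    by rewrite -ler_pdivlMr; [rewrite -mulrA -invfM ltW|lra].
  by have : 0 <= `|s| by []; nra.
pose x1 := x0 + s *: e.
have x1x0 : x1 - x0 = s *: e by rewrite addrAC subrr add0r.
have Ux1 : U x1.
  rewrite /U /= x1x0 normrZ; split; first by move: nse; lra.
  by rewrite axisZ axis_e mulr1.
have Tx1 : `|T x1 - x1| <= `|s| * `|e|.
  rewrite /T addrAC subrr add0r normrZ gtr0_norm//.
  have : `|f x1 - x1| <= eps * (`|s| * `|e|).
    have := Hr x1 x0 (UD _ Ux1) Dx0 (Ur _ Ux1); rewrite fx0 x1x0 normrZ.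
    rewrite mulmxL axisZ axis_e mulr1 mulr_natl mulr2n scalerDl addrK.
    by rewrite subrr normr0 -addrA -opprD; apply => //; exact: Ur.
  have := HK (f x1 - x1); have nn : 0 <= `|s| * `|e| by rewrite mulr_ge0.
  move=> h1 /(ler_wpM2l (ltW K0)) h2.
  have : K * eps * (`|s| * `|e|) <= 2^-1 * (`|s| * `|e|) by rewrite ler_wpM2r// mulrC.
  by move: h1 h2 nn; rewrite mulrA; move: (_ * _) => a; lra.
have UT x : U x -> U (T x).
  move=> Ux; split.
    have -> : T x - x0 = (T x - T x1) + (T x1 - x1) + (x1 - x0).
      by rewrite !subrKA.
    apply: le_trans (ler_normD _ _) _; rewrite x1x0 normrZ.
    have := ler_normD (T x - T x1) (T x1 - x1); have := TT x x1 Ux Ux1.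
    have : `|x - x1| <= `|x - x0| + `|s| * `|e|.
      rewrite -normrZ -x1x0; have -> : x - x1 = (x - x0) - (x1 - x0).
        by rewrite opprB addrA subrK.
      exact: ler_normB.
    by case: Ux => + _; move: nse Tx1; lra.
  have := Ux.2; rewrite /T !axisB => <-; congr (_ - _).
  by rewrite axisD axisZ axisQ mulr0 addr0.
have cU : closed U.
  pose N (x : 'rV[R]_n) : R := `|x - x0|; pose A (x : 'rV[R]_n) := axis l (x - x0).
  have cN : continuous N.
    move=> x; apply: (@continuous_comp _ _ _ (fun x => x - x0) (fun x => `|x|)).
      by apply: (@continuousB _ _ _ id (cst x0)) => //; exact: cst_continuous.
    exact: norm_continuous.
  have cA : continuous A.
    move=> x; apply: (@continuous_comp _ _ _ (fun x => x - x0) (axis l)).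
      by apply: (@continuousB _ _ _ id (cst x0)) => //; exact: cst_continuous.
    exact: axis_continuous.
  have -> : U = N @^-1` [set t | t <= rho'] `&` A @^-1` [set s] by [].
  apply: closedI; first by move/continuous_closedP: cN; apply; exact: closed_le.
  by move/continuous_closedP: cA; apply; exact: closed_eq.
have q0 : 0 <= 4^-1 :> R by rewrite invr_ge0.
have q1 : 4^-1 < 1 :> R by lra.
have U0 : U !=set0 by exists x1.
have [x Ux xT] := banach_row cU U0 UT q0 q1 TT.
exists x; split; [exact: UD|exact: Ur| |exact: Ux.2].
have Dx := UD x Ux; have xr := Ur x Ux.
have [Dfx ffx] := Df Dx (rr0 _ xr).
have fxr : `|f x - x0| < r.
  have := Hr x x0 Dx Dx0 xr; rewrite fx0 subrr normr0 => /(_ r_gt0) h1.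
  apply: (@le_lt_trans _ _ ((K' + 1) * `|x - x0|)).
    rewrite -[f x - x0](subrK ((x - x0) *m L)).
    apply: le_trans (ler_normD _ _) _; have := HK' (x - x0).
    have : eps * `|x - x0| <= 2^-1 * `|x - x0| by rewrite ler_wpM2r.
    have : 0 <= `|x - x0| by [].
    by rewrite mulrDl mul1r; lra.
  apply: (@le_lt_trans _ _ ((K' + 1) * rho')).
    by apply: ler_wpM2l; [rewrite addr_ge0// ltW|case: Ux].
  by rewrite /rho' mulrCA gtr_pMr// ltr_pdivrMr// mul1r; lra.
pose u := f x - x.
have uQ : u *m Q = 0.
  have /eqP := xT; rewrite /T -subr_eq0 opprD addrA subrr add0r oppr_eq0.
  by rewrite scaler_eq0 invr_eq0 pnatr_eq0 /= => /eqP.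
have uL : u *m L = u.
  move: uQ; rewrite mulmxL QE => /eqP; rewrite subr_eq0 => /eqP uE.
  by rewrite -scalerA -uE scaler_nat mulr2n addrK.
have := Hr (f x) x Dfx Dx fxr xr; rewrite ffx -/u uL -[x - f x]opprB -/u -opprD normrN.
rewrite -mulr2n -scaler_nat normrZ => Hu.
apply/eqP; rewrite -subr_eq0 -/u -normr_le0.
have : eps * `|u| <= 2^-1 * `|u| by rewrite ler_wpM2r.
by move: Hu; rewrite ger0_norm//; lra.
Qed.

End FixedCurve.

(** * Strict derivatives of maps between manifolds *)

Section ChartImage.
Context {R : realType}.

Lemma chart_in n (H : set 'rV[R]_n) (T : topologicalType) (c : chart T H) p :
  dom c p -> H (c p).
Proof.
move=> cp; have [W _ E] := coord_image c.
by have [] : (W `&` H) (c p) by rewrite -E; exists p.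
Qed.

(** The image of an open set under a chart is open in H: the inverse of a chart
is continuous, and the image of a chart is open in H. *)
Lemma chart_image_near n (H : set 'rV[R]_n) (T : topologicalType) (c : chart T H)
    (V : set T) p : open V -> dom c p -> V p ->
  exists2 r : R, 0 < r & forall x, H x -> `|x - c p| < r ->
    [/\ dom c (param c x), V (param c x) & c (param c x) = x].
Proof.
move=> oV cp Vp; have [W oW E] := coord_image c.
have Wcp : W (c p) by have [] : (W `&` H) (c p) by rewrite -E; exists p.
have := param_continuous_on (c := c); move=> /subspace_continuousP/(_ (c p)).
have cim : (c @` dom c) (c p) by exists p.
move=> /(_ cim) cv; have /cv nV' : nbhs (param c (c p)) V.
  by rewrite coordK//; exact: open_nbhs_nbhs.
have nV : \forall x \near c p, (c @` dom c) x -> V (param c x) by exact: nV'.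
have : \forall x \near c p, W x /\ ((c @` dom c) x -> V (param c x)).
  by apply: filterI => //; exact: open_nbhs_nbhs.
move=> /nbhs_dist[r r0 Hr].
exists r => // x Hx /Hr[Wx Vx].
have cx : (c @` dom c) x by rewrite E.
have [q cq qx] := cx; move: (Vx cx); rewrite -qx coordK//.
Qed.

Lemma coord_near n (H : set 'rV[R]_n) (T : topologicalType) (c : chart T H) :
  {in dom c, continuous c}.
Proof.
have := coord_continuous_on (c := c).
by rewrite continuous_open_subspace//; exact: dom_open.
Qed.

End ChartImage.

(** Positive coordinate directions point into H.  They span, so they determine
the strict derivatives of functions on open subsets of H; see
[strict_tangent_unique]. *)
Definition corner_closed (R : realType) n (H : set 'rV[R]_n) : Prop :=
  forall x i (t : R), H x -> 0 <= t -> H (x + t *: 'e_i).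

Section StrictTangent.
Context {R : realType}.

(** The strict form of [tangent_map]; it exists for all smooth maps
([strict_tangent_ex]), and it is unique. *)
Definition strict_tangent m n (H : set 'rV[R]_m) (K : set 'rV[R]_n)
    (M : compact_mfd H) (N : compact_mfd K) (f : M -> N)
    i j p (D : 'M[R]_(m, n)) : Prop :=
  [/\ dom (chart_at i) p, dom (chart_at j) (f p)
    & strict_diff (local_dom f i j) (local_expr f i j) (chart_at i p) D].

Section Maps.
Context {m n : nat} {H : set 'rV[R]_m} {K : set 'rV[R]_n}.
Context {M : compact_mfd H} {N : compact_mfd K}.

Lemma local_dom_in (f : M -> N) i j q :
  dom (chart_at i) q -> dom (chart_at j) (f q) -> local_dom f i j (chart_at i q).
Proof. by move=> iq jq; exists q. Qed.

Lemma local_exprE (f : M -> N) i j q :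
  dom (chart_at i) q -> local_expr f i j (chart_at i q) = chart_at j (f q).
Proof. by move=> iq; rewrite /local_expr /= coordK. Qed.

Lemma local_dom_near (f : M -> N) i j q : continuous f ->
  dom (chart_at i) q -> dom (chart_at j) (f q) ->
  exists2 r : R, 0 < r & forall x, H x -> `|x - chart_at i q| < r ->
    local_dom f i j x.
Proof.
move=> cf iq jq.
have oV : open (f @^-1` dom (chart_at j)).
  by move/continuousP: cf; apply; exact: dom_open.
have [r r0 Hr] := chart_image_near oV iq jq; exists r => // x Hx /(Hr x Hx)[].
by move=> d1 d2 <-; apply: local_dom_in.
Qed.

Lemma strict_tangent_ex (f : M -> N) i j q : smooth_map f ->
  dom (chart_at i) q -> dom (chart_at j) (f q) ->
  exists D, strict_tangent f i j q D.
Proof.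
move=> [_ sf] iq jq.
have [D HD] := smooth_strict_diff (sf i j) (local_dom_in iq jq).
by exists D; split.
Qed.

Lemma strict_tangent_map (f : M -> N) i j q D :
  strict_tangent f i j q D -> tangent_map f i j q D.
Proof.
move=> [iq jq sD]; split=> //; apply: strict_diff_within sD.
exact: local_dom_in.
Qed.

Lemma strict_tangent_unique (f : M -> N) i j q D D' : corner_closed H ->
  continuous f -> strict_tangent f i j q D -> strict_tangent f i j q D' -> D = D'.
Proof.
move=> HH cf [iq jq sD] [_ _ sD'].
have [r r0 Hr] := local_dom_near cf iq jq.
apply/row_matrixP => k; apply/eqP; rewrite -subr_eq0 -normr_le0.
apply/ler_addgt0Pr => e e0; rewrite add0r !rowE -mulmxBr.
have ne : `|'e_k : 'rV[R]_m| <= 1.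
  by apply: norm_row_le => // l; rewrite !mxE eqxx /=; case: (_ == _); rewrite ?normr1 ?normr0.
have [r' r'0 Hr'] := sD _ e0.
apply: le_trans (_ : e * `|'e_k : 'rV[R]_m| <= e); last by rewrite ler_piMr// ltW.
apply: (strict_diff_dist Hr' sD').
- exact: local_dom_in.
- by split; [exact: local_dom_in|rewrite /= subrr normr0].
have near_t : \forall t \near (0 : R)^'+, [/\ 0 < t, t < r & t < r'].
  near=> t; split; near: t; [exact: nbhs_right_gt|exact: nbhs_right_lt|].
  exact: nbhs_right_lt.
apply: filterS near_t => t [t0 tr tr'].
set w := chart_at i q.
have wt : `|w + t *: 'e_k - w| <= t.
  by rewrite addrAC subrr add0r normrZ gtr0_norm// ler_piMr// ltW.
have dw : local_dom f i j (w + t *: 'e_k).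
  apply: Hr; last exact: le_lt_trans tr.
  by apply: HH; [exact: chart_in|exact: ltW].
by split=> //; split=> //=; exact: le_lt_trans tr'.
Unshelve. all: by end_near. Qed.

End Maps.

Lemma strict_tangent_comp m n p (H : set 'rV[R]_m) (K : set 'rV[R]_n)
    (G : set 'rV[R]_p) (M : compact_mfd H) (N : compact_mfd K) (Q : compact_mfd G)
    (f : M -> N) (g : N -> Q) i j k q D D' : continuous f ->
  strict_tangent f i j q D -> strict_tangent g j k (f q) D' ->
  strict_tangent (g \o f) i k q (D *m D').
Proof.
move=> cf [iq jq sD] [_ kq sD']; split=> //.
have [r r0 Hr] := local_dom_near cf iq jq.
pose A := local_dom (g \o f) i k `&` local_dom f i j.
have AB a : A a -> local_dom g j k (local_expr f i j a).
  move=> [[y [iy ky] <-] [z [iz jz] /esym yz]].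
  have zy : y = z by rewrite -(coordK iy) yz coordK.
  by rewrite local_exprE//; apply: local_dom_in => //; rewrite zy.
have sD1 : strict_diff A (local_expr f i j) (chart_at i q) D.
  by apply: (strict_diff_local ltr01 _ sD) => a [_].
have := @strict_diff_comp _ _ _ _ A (local_dom g j k) (local_expr f i j)
  (local_expr g j k) (chart_at i q) D D' 1 _ ltr01 (fun a Aa _ => AB a Aa) sD1.
rewrite local_exprE// => sDD'.
apply: (strict_diff_local r0 _ (sDD' _ sD')); last first.
  by split; exact: local_dom_in.
move=> a [y [iy ky] <-] /(Hr _ (chart_in iy)) aB.
have Aa : A (chart_at i y) by split=> //; exact: local_dom_in.
split=> //; have [z [iz jz] /esym yz] := aB.
have zy : y = z by rewrite -(coordK iy) yz coordK.
by rewrite local_exprE//= local_exprE// local_exprE// zy.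
Qed.

End StrictTangent.

(** * Fixed points of smooth involutions *)

Section Corners.
Context {R : realType}.

Lemma corner_closedT n : corner_closed [set: 'rV[R]_n].
Proof. by []. Qed.

Lemma corner_closed_half_space d : corner_closed (@half_space R d).
Proof.
move=> x i t; rewrite /half_space /= !mxE => x0 t0.
by rewrite addr_ge0// mulr_ge0.
Qed.

End Corners.

Section StrictTangentId.
Context {R : realType} {n : nat} {H : set 'rV[R]_n}.

Lemma id_smooth (M : compact_mfd H) : smooth_map (@id M).
Proof. split; first by move=> x; exact: cvg_id.
by move=> i j; exact: (@mfd_transition _ _ _ M i j).
Qed.

Lemma strict_tangent_id (M : compact_mfd H) (i : chart_index M) p :
  dom (chart_at i) p -> strict_tangent (@id M) i i p 1%:M.
Proof.
move=> ip; split=> //.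
apply: (strict_diff_local ltr01 _ (@strict_diff_id _ _ setT _)) => a.
by move=> [q [iq _] <-] _; split=> //; rewrite local_exprE.
Qed.

End StrictTangentId.

Section Equivariant.
Context {R : realType} {m n : nat} {H : set 'rV[R]_m} {K : set 'rV[R]_n}.
Context {M : C2_mfd H} {N : C2_mfd K}.
Hypothesis HH : corner_closed H.

Lemma flip_continuous n' (G : set 'rV[R]_n') (Q : C2_mfd G) : continuous (@flip _ _ _ Q).
Proof. exact: (@flip_smooth _ _ _ Q).1. Qed.

Lemma equivariant_strict_tangent (f : M -> N) i j p D S S' : continuous f ->
  (forall q, f (flip q) = flip (f q)) -> flip p = p ->
  strict_tangent f i j p D -> strict_tangent (@flip _ _ _ M) i i p S ->
  strict_tangent (@flip _ _ _ N) j j (f p) S' -> S *m D = D *m S'.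
Proof.
move=> cf ff fp sD sS sS'.
have sD' : strict_tangent f i j (flip p) D by rewrite fp.
have h1 := strict_tangent_comp (@flip_continuous _ _ M) sS sD'.
have h2 := strict_tangent_comp cf sD sS'.
have e : f \o @flip _ _ _ M = @flip _ _ _ N \o f by apply/funext => q /=.
rewrite e in h1.
apply: (strict_tangent_unique HH _ h1 h2).
by move=> q; apply: continuous_comp; [exact: cf|exact: flip_continuous].
Qed.

End Equivariant.

Section FixedPoints.
Context {R : realType} {n : nat} {H : set 'rV[R]_n} (W : C2_mfd H).
Hypothesis HH : corner_closed H.
Local Notation inv := (@flip R n H W).

Lemma flip_tangent_sqr (i : chart_index W) p S : inv p = p ->
  strict_tangent inv i i p S -> S *m S = 1%:M.
Proof.
move=> fp sS; have sS' : strict_tangent inv i i (inv p) S by rewrite fp.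
have h := strict_tangent_comp (@flip_continuous _ _ _ W) sS sS'.
have e : inv \o inv = id by apply/funext => q /=; rewrite flipK.
rewrite e in h; case: (sS) => ip _ _.
exact: (strict_tangent_unique HH (@id_smooth _ _ _ W).1 h (strict_tangent_id ip)).
Qed.

(** The matrices in two charts are conjugate under the derivative of the
transition map. *)
Lemma flip_tangent_trace (i j : chart_index W) p S S' : inv p = p ->
  strict_tangent inv i i p S -> strict_tangent inv j j p S' -> \tr S = \tr S'.
Proof.
move=> fp sS sS'; case: (sS) (sS') => ip _ _ [jp _ _].
have [cid sid] := id_smooth W.
have [T sT] := strict_tangent_ex (id_smooth W) ip (jp : dom _ (id p)).
have [T' sT'] := strict_tangent_ex (id_smooth W) jp (ip : dom _ (id p)).
have TT' : T *m T' = 1%:M.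
  have h := strict_tangent_comp cid sT sT'.
  exact: (strict_tangent_unique HH cid h (strict_tangent_id ip)).
have ST : S *m T = T *m S'.
  by apply: (equivariant_strict_tangent HH cid _ fp sT sS sS').
rewrite -[S']mul1mx -(mulmx1C TT') -mulmxA -ST mxtrace_mulC -mulmxA TT'.
by rewrite mulmx1.
Qed.

Lemma fixed_closed : closed [set p | inv p = p].
Proof.
move=> p clp; apply: contrapT => /= /eqP fp.
have hW := @mfd_hausdorff _ _ _ W.
move: hW; rewrite open_hausdorff => /(_ _ _ fp) [[A B] /= [Ap Bp] [oA oB AB0]].
have nA : nbhs p (inv @^-1` A).
  by apply: flip_continuous; apply: open_nbhs_nbhs; split=> //; rewrite inE in Ap.
have nB : nbhs p B by apply: open_nbhs_nbhs; split=> //; rewrite inE in Bp.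
have [q [/= fq [Aq Bq]]] := clp _ (filterI nA nB).
rewrite /= fq in Aq.
by have : (A `&` B) q by []; rewrite (eqP AB0).
Qed.

Lemma local_dom_flip_near (i : chart_index W) p : inv p = p ->
  dom (chart_at i) p -> exists2 r : R, 0 < r & forall x, H x ->
    `|x - chart_at i p| < r -> local_dom inv i i x.
Proof.
move=> fp ip; apply: local_dom_near => //; first exact: flip_continuous.
by rewrite fp.
Qed.

(** The diagonal entries of the differentials at p and q differ by less than
1/n when q is close to p, so their traces differ by less than 1.  As both traces
are of the form 2 r - n, they are equal. *)
Lemma flip_trace_near (i : chart_index W) p S : inv p = p ->
  strict_tangent inv i i p S -> exists2 r : R, 0 < r &
    forall q S', inv q = q -> `|chart_at i q - chart_at i p| < r ->
      strict_tangent inv i i q S' -> \tr S' = \tr S.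
Proof.
move=> fp sS; case: (sS) => ip _ sdS.
have e0 : 0 < (n.+1%:R)^-1 :> R by rewrite invr_gt0.
have [r r0 Hr] := sdS _ e0; exists r => // q S' fq qr sS'.
case: (sS') => iq iq' sdS'.
have [r' r'0 Hr'] := local_dom_flip_near fq iq.
pose w := chart_at i q; pose A := local_dom inv i i.
have ne (k : 'I_n) : `|'e_k : 'rV[R]_n| <= 1.
  apply: norm_row_le => // l; rewrite !mxE eqxx /=.
  by case: (_ == _); rewrite ?normr1 ?normr0.
have near_t : \forall t \near (0 : R)^'+,
    [/\ 0 < t, t < r' & t < r - `|w - chart_at i p|].
  near=> t; split; near: t; [exact: nbhs_right_gt|exact: nbhs_right_lt|].
  by apply: nbhs_right_lt; rewrite subr_gt0.
have diag (k : 'I_n) : `|S k k - S' k k| <= n.+1%:R^-1.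
  apply: le_trans (_ : `|('e_k : 'rV[R]_n) *m (S - S')| <= _).
    have <- : (('e_k : 'rV[R]_n) *m (S - S')) 0 k = S k k - S' k k.
      by rewrite -rowE !mxE.
    exact: norm_coord_le.
  apply: le_trans (_ : n.+1%:R^-1 * `|'e_k : 'rV[R]_n| <= _); last first.
    by rewrite ler_piMr// ltW.
  apply: (strict_diff_dist Hr sdS').
  - exact: local_dom_in.
  - by split=> //; exact: local_dom_in.
  apply: filterS near_t => t [t0 tr' tr].
  have wt : `|w + t *: 'e_k - w| <= t.
    by rewrite addrAC subrr add0r normrZ gtr0_norm// ler_piMr// ltW.
  have dw : A (w + t *: 'e_k).
    apply: Hr'; last exact: le_lt_trans tr'.
    by apply: HH; [exact: chart_in|exact: ltW].
  split=> //; split=> //=; rewrite -[_ - _](subrKA w).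
  by apply: le_lt_trans (ler_normD _ _) _; rewrite -ltrBrDr; apply: le_lt_trans tr.
have trS : `|\tr S - \tr S'| < 1.
  rewrite /mxtrace -sumrB; apply: le_lt_trans (ler_norm_sum _ _ _) _.
  apply: le_lt_trans (_ : \sum_(k < n) n.+1%:R^-1 < 1).
    by apply: ler_sum => k _; exact: diag.
  by rewrite sumr_const card_ord -[_ *+ n]mulr_natl ltr_pdivrMr// mul1r ltr_nat.
have [a aS] := involution_trace (flip_tangent_sqr fp sS).
have [b bS] := involution_trace (flip_tangent_sqr fq sS').
move: trS; rewrite aS bS => trS.
have : `|2 * a%:R - 2 * b%:R : R| < 1.
  by move: trS; rewrite opprB addrA subrK.
rewrite -mulrBr normrM gtr0_norm// => ab.
have [ab'|ba'|->//] := ltngtP a b.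
  have : 1 <= `|a%:R - b%:R : R|.
    by rewrite distrC -natrB ?(ltnW ab')// normr_nat ler1n subn_gt0.
  by move: ab; lra.
have : 1 <= `|a%:R - b%:R : R|.
  by rewrite -natrB ?(ltnW ba')// normr_nat ler1n subn_gt0.
by move: ab; lra.
Unshelve. all: by end_near. Qed.

(** The trace is 2 - n exactly when the (+1)-eigenspace of the differential is a
line; these are the points of the fixed set where it is a curve. *)
Definition fixed_curve_set : set W := [set p | inv p = p /\
  exists i S, strict_tangent inv i i p S /\ \tr S = 2 - n%:R].

Lemma fixed_curve_setP (i : chart_index W) p S : inv p = p ->
  strict_tangent inv i i p S -> fixed_curve_set p <-> \tr S = 2 - n%:R.
Proof.
move=> fp sS; split=> [[_ [j [S' [sS' <-]]]]|trS]; last by split=> //; exists i, S.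
exact: flip_tangent_trace sS sS'.
Qed.

Lemma flip_tangent_ex (i : chart_index W) p : inv p = p -> dom (chart_at i) p ->
  exists S, strict_tangent inv i i p S.
Proof.
move=> fp ip; apply: strict_tangent_ex => //; first exact: flip_smooth.
by rewrite fp.
Qed.

Lemma open_chart_ball (i : chart_index W) (x : 'rV[R]_n) (r : R) :
  open (dom (chart_at i) `&` [set q | `|chart_at i q - x| < r]).
Proof.
rewrite openE => q [iq /= qr]; apply: filterI.
  by apply: open_nbhs_nbhs; split=> //; exact: dom_open.
have := @coord_near _ _ _ _ (chart_at i) q (mem_set iq).
move=> /(_ [set y | `|y - x| < r]); apply; apply: (proj2 (nbhs_dist _ _)).
exists (r - `|chart_at i q - x|); first by rewrite subr_gt0.
move=> y yr; rewrite /= -(subrKA (chart_at i q)).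
by apply: le_lt_trans (ler_normD _ _) _; rewrite -ltrBrDr.
Qed.

Lemma fixed_curve_set_near (i : chart_index W) p :
  inv p = p -> dom (chart_at i) p -> exists2 r : R, 0 < r &
    forall q, dom (chart_at i) q -> `|chart_at i q - chart_at i p| < r ->
      inv q = q -> fixed_curve_set q <-> fixed_curve_set p.
Proof.
move=> fp ip; have [S sS] := flip_tangent_ex fp ip.
have [r r0 Hr] := flip_trace_near fp sS; exists r => // q iq qr fq.
have [S' sS'] := flip_tangent_ex fq iq.
apply: (iff_trans (fixed_curve_setP fq sS')).
rewrite (Hr q S' fq qr sS'); exact: iff_sym (fixed_curve_setP fp sS).
Qed.

Lemma fixed_curve_set_compact : compact fixed_curve_set.
Proof.
apply: (subclosed_compact _ (@mfd_compact _ _ _ W)) => //.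
move=> p clp; have fp : inv p = p.
  by apply: fixed_closed => B /clp[q [[fq _] Bq]]; exists q.
have [i ip] := mfd_cover p.
have [r r0 Hr] := fixed_curve_set_near fp ip.
have oU := open_chart_ball i (chart_at i p) r.
have [|q [Fq [iq qr]]] := clp _ (open_nbhs_nbhs (conj oU _)).
  by split=> //=; rewrite subrr normr0.
by apply: (Hr q iq qr Fq.1).1.
Qed.

End FixedPoints.
Arguments fixed_curve_set {R n H} W _.

(** * Arcs of fixed points *)

Section FixedArc.
Context {R : realType} {n : nat} {H : set 'rV[R]_n} (W : C2_mfd H).
Hypothesis HH : corner_closed H.
Local Notation inv := (@flip R n H W).

(** In the chart i, [fixed_curve] parametrizes the fixed points near p by the
values s in S of [axis l] with |s| < d; dividing by d, the parameter t = s / d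
runs over J. *)
Lemma fixed_arc (i : chart_index W) p (l : 'cV[R]_n) (e : 'rV[R]_n)
    (S J : set R) (r0 : R) :
  fixed_curve_set W p -> e *m l = 1%:M ->
  strict_tangent inv i i p (2 *: (l *m e) - 1%:M) ->
  0 < r0 -> (forall x, `|x - chart_at i p| < r0 ->
    (H x <-> S (axis l (x - chart_at i p)))) ->
  (forall d t, 0 < d -> (J t <-> `|t| < 1 /\ S (d * t))) ->
  exists U g h, [/\ parametrizes (fixed_curve_set W) J U g h, U p & h p = 0].
Proof.
move=> Fp el sL r0_gt0 HS JS; have fp := Fp.1; case: (sL) => ip ip' sdL.
set c := chart_at i; set x0 := c p.
pose f := local_expr inv i i; pose D := local_dom inv i i.
have DP x : D x <-> exists q, [/\ dom c q, dom c (inv q) & c q = x].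
  by split=> [[q [? ?] <-]|[q [? ? <-]]]; [exists q|exists q].
have fE q : dom c q -> f (c q) = c (inv q) by exact: local_exprE.
have [r1 r1_gt0 Hr1] := local_dom_flip_near fp ip.
have [r2 r2_gt0 Hr2] := fixed_curve_set_near HH fp ip.
have DH x : D x -> H x by move=> /DP[q [iq _ <-]]; exact: chart_in.
have DS x : `|x - x0| < Num.min r0 r1 -> (D x <-> S (axis l (x - x0))).
  rewrite lt_min => /andP[xr0 xr1]; split=> [/DH/(HS _ xr0)//|].
  by move=> /(HS _ xr0)/Hr1; exact.
have Df x : D x -> `|x - x0| < Num.min r0 r1 -> D (f x) /\ f (f x) = x.
  move=> /DP[q [iq iq' <-]] _; rewrite !fE// flipK; split=> //.
  by apply/DP; exists (inv q); rewrite flipK.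
have Dx0 : D x0 by apply/DP; exists p.
have fx0 : f x0 = x0 by rewrite fE// fp.
have r01 : 0 < Num.min r0 r1 by rewrite lt_min r0_gt0.
have rho0 : 0 < Num.min r2 (Num.min r0 r1) by rewrite lt_min r2_gt0.
have [r [d [C [r_gt0 + d0 C0 [Hinj Hex]]]]] :=
  fixed_curve el sdL r01 DS Df Dx0 fx0 rho0.
rewrite le_min => /andP[rr2 rr01].
have fixedD q : dom c q -> inv q = q -> D (c q) /\ f (c q) = c q.
  by move=> iq fq; rewrite fE// fq; split=> //; apply/DP; exists q; rewrite fq.
have /choice [y yP] : forall t, exists x, J t ->
    [/\ D x, `|x - x0| < r, f x = x & axis l (x - x0) = d * t].
  move=> t; have [Jt|nJ] := pselect (J t); last by exists 0.
  have [t1 St] := (JS d t d0).1 Jt.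
  have [|x Hx] := Hex (d * t) St; last by exists x.
  by rewrite normrM (gtr0_norm d0) gtr_pMr.
pose g t := param c (y t).
have gP t : J t -> [/\ dom c (g t), c (g t) = y t & inv (g t) = g t].
  move=> /yP[/DP[q [iq iq' qy]] _ fy _]; rewrite /g -qy coordK//; split=> //.
  by rewrite -(coordK iq') -fE// qy fy -qy coordK.
pose h q := axis l (c q - x0) / d.
pose U := (dom c `&` [set q | `|c q - x0| < r]) `&`
          (dom c `&` [set q | `|axis l (c q - x0)| < d]).
have ch : {in dom c, continuous (fun q => axis l (c q - x0))}.
  move=> q iq; apply: (@continuous_comp _ _ _ c (fun x => axis l (x - x0))).
    exact: coord_near.
  apply: (@continuous_comp _ _ _ (fun x => x - x0) (axis l)).
    by apply: (@continuousB _ _ _ id (cst x0)) => //; exact: cst_continuous.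
  exact: axis_continuous.
exists U, g, h; split; last 2 first.
- by split; split=> //=; rewrite -/x0 subrr ?normr0// /axis mul0mx mxE normr0.
- by rewrite /h -/x0 subrr /axis mul0mx mxE mul0r.
split.
- apply: openI; first exact: open_chart_ball.
  rewrite openE => q [iq /= qd]; apply: filterI.
    by apply: open_nbhs_nbhs; split=> //; exact: dom_open.
  have := ch q (mem_set iq) (fun s => `|s| < d); apply; apply: (proj2 (nbhs_dist _ _)).
  exists (d - `|axis l (c q - x0)|); first by rewrite subr_gt0.
  move=> s sr; rewrite -[s](subrK (axis l (c q - x0))).
  by apply: le_lt_trans (ler_normD _ _) _; rewrite -ltrBrDr.
- move=> t Jt; have [iq qy fq] := gP t Jt; have [Dy yr fy ay] := yP t Jt.
  have [t1 _] := (JS d t d0).1 Jt.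
  split; last first.
    split; split=> //=; rewrite qy// ay normrM (gtr0_norm d0).
    by rewrite gtr_pMr.
  apply: (Hr2 (g t) iq _ fq).2 => //; rewrite -/c qy.
  exact: lt_le_trans rr2.
- move=> t Jt; have [_ qy _] := gP t Jt; have [_ _ _ ay] := yP t Jt.
  by rewrite /h qy ay mulrAC divff ?mul1r// gt_eqF.
- move=> q [[fq _] [[iq /= qr] [_ /= qd]]].
  apply/(JS d (h q) d0); split.
    by rewrite /h normrM normfV (gtr0_norm d0) ltr_pdivrMr// mul1r.
  rewrite /h [d * _]mulrC divfK ?gt_eqF//.
  have [Dq _] := fixedD q iq fq; apply: (DS _ _).1 Dq.
  exact: lt_le_trans rr01.
- move=> q [[fq Fq] [[iq /= qr] [_ /= qd]]].
  have [Dq fcq] := fixedD q iq fq.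
  have Jq : J (h q).
    apply/(JS d (h q) d0); split.
      by rewrite /h normrM normfV (gtr0_norm d0) ltr_pdivrMr// mul1r.
    rewrite /h [d * _]mulrC divfK ?gt_eqF//; apply: (DS _ _).1 Dq.
    exact: lt_le_trans rr01.
  have [Dy yr fy ay] := yP _ Jq.
  suff : y (h q) = c q by rewrite /g => ->; rewrite coordK.
  apply/eqP; rewrite -subr_eq0 -normr_le0.
  apply: le_trans (Hinj _ _ Dy Dq yr qr fy fcq) _.
  rewrite -(subrKA x0) -[x0 - c q]opprB axisB ay /h [d * _]mulrC divfK ?gt_eqF//.
  by rewrite subrr normr0 mulr0.
- apply/subspace_continuousP => t Jt V nV.
  have [iq qy fq] := gP t Jt; have [Dy yr fy ay] := yP t Jt.
  have [r3 r3_gt0 Hr3] := chart_image_near (@open_interior _ V) iq nV.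
  apply: (proj2 (nbhs_dist _ _)).
  exists (r3 / (C * d)); first by rewrite divr_gt0// mulr_gt0.
  move=> s sr Js; have [_ qs fs] := gP s Js; have [Dys ysr fys ays] := yP s Js.
  suff ysr3 : `|y s - c (g t)| < r3.
    by apply: (@interior_subset _ V); case: (Hr3 (y s) (DH _ Dys) ysr3).
  rewrite qy; apply: le_lt_trans (Hinj _ _ Dys Dy ysr yr fys fy) _.
  rewrite -(subrKA x0) -[x0 - y t]opprB axisB ays ay -mulrBr normrM (gtr0_norm d0).
  by rewrite mulrA mulrC -ltr_pdivlMr// mulr_gt0.
- move=> q; rewrite inE => -[[iq _] _].
  apply: (@continuousM _ _ (fun q => axis l (c q - x0)) (fun=> d^-1)).
    by apply: ch; rewrite inE.
  exact: cst_continuous.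
Qed.

End FixedArc.

(** * Fixed points on the boundary *)

Section BoundaryLinearAlgebra.
Context {R : realType} {m : nat}.

(** The rows of D span a hyperplane invariant under S, where S acts as B.  The
idempotent E = 1 - X D, for X a right inverse of D, projects onto a complement
of this hyperplane, and c is the action of S on the quotient line. *)
Lemma extension_trace (B : 'M[R]_m) (S : 'M[R]_m.+1) (D : 'M[R]_(m, m.+1)) :
  row_free D -> B *m D = D *m S -> S *m S = 1%:M ->
  exists2 c : R, c ^+ 2 = 1 & \tr S = \tr B + c.
Proof.
move=> /row_freeP[X DX] BD SS; pose E := 1%:M - X *m D.
have EE : E *m E = E.
  rewrite /E mulmxBr mulmx1 mulmxBl mul1mx -mulmxA (mulmxA D) DX mul1mx.
  by rewrite subrr subr0.
have trE : \tr E = 1.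
  by rewrite /E linearB /= mxtrace1 mxtrace_mulC DX mxtrace1 -natr1 addrAC subrr add0r.
have [l [e [el leE]]] := idempotent_line EE trE.
have Dl : D *m l = 0.
  rewrite -[l]mulmx1 -el (mulmxA l) leE mulmxA /E mulmxBr mulmx1 (mulmxA D) DX.
  by rewrite mul1mx subrr mul0mx.
pose c := (e *m S *m l) 0 0; have cE : e *m S *m l = c%:M by exact: mx11_scalar.
exists c.
  suff : c%:M *m c%:M = 1%:M :> 'M[R]_1.
    by move=> /matrixP/(_ 0 0); rewrite -scalar_mxM !mxE eqxx !mulr1n.
  rewrite -cE -!mulmxA (mulmxA l) leE /E mulmxBl mul1mx.
  by rewrite -!mulmxA (mulmxA D) -BD -!mulmxA Dl !mulmx0 subr0 (mulmxA S) SS mul1mx.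
rewrite -[S in LHS]mul1mx -[1%:M](subrK (X *m D)) -/E addrC mulmxDl linearD /=.
congr (_ + _); first by rewrite -mulmxA -BD mulmxA mxtrace_mulC mulmxA DX mul1mx.
by rewrite -leE -mulmxA mxtrace_mulC cE mxtrace_scalar.
Qed.

(** The rows of D span the hyperplane of the vectors with coordinate 0 equal to
0, where S acts as -1.  On the quotient S acts by S 0 0, which is 1 or -1; being
nonnegative it is 1, and the fixed line of S is transverse to the hyperplane. *)
Lemma inward_line (S : 'M[R]_(1 + m)) (D : 'M[R]_(m, 1 + m)) :
  row_free D -> (forall k, D k 0 = 0) -> (- 1%:M) *m D = D *m S ->
  S *m S = 1%:M -> 0 <= S 0 0 ->
  exists e : 'rV[R]_(1 + m), e *m col_mx 1%:M 0 = 1%:M /\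
    S = 2 *: (col_mx 1%:M 0 *m e) - 1%:M.
Proof.
move=> Dfree D0 BD SS S00.
have Dl : lsubmx D = 0.
  by apply/matrixP => k j; rewrite !mxE ord1 (_ : lshift m 0 = 0) ?D0//; exact: val_inj.
pose D1 : 'M[R]_m := rsubmx D.
have DE : D = row_mx 0 D1 by rewrite -[LHS]hsubmxK Dl.
have D1u : D1 \in unitmx.
  have /row_freeP[X DX] := Dfree.
  suff : D1 *m dsubmx X = 1%:M by move=> /mulmx1_unit[].
  by rewrite -DX DE -[X]vsubmxK mul_row_col mul0mx add0r col_mxKd.
have dS : dsubmx S = row_mx 0 (- 1%:M).
  have : invmx D1 *m (D *m S) = row_mx 0 (- 1%:M).
    rewrite -BD mulNmx mul1mx mulmxN DE mul_mx_row mulmx0 mulVmx//.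
    by rewrite opp_row_mx oppr0.
  suff -> : D *m S = D1 *m dsubmx S by rewrite mulKmx.
  by rewrite {1}DE -{1}[S]vsubmxK mul_row_col mul0mx add0r.
pose a : R := S 0 0; pose w : 'rV[R]_m := ursubmx S.
have SE : S = block_mx a%:M w 0 (- 1%:M).
  rewrite -[LHS]vsubmxK dS -[usubmx S]hsubmxK; congr (col_mx (row_mx _ _) _).
  apply/matrixP => i j; rewrite !ord1 !mxE ?eqxx ?mulr1n /= /a.
  by congr (S _ _); exact: val_inj.
have aa : a = 1.
  have : a ^+ 2 = 1.
    move: SS; rewrite SE mulmx_block scalar_mx_block => /eq_block_mx[+ _ _ _].
    rewrite mulmx0 addr0 -scalar_mxM => /matrixP/(_ 0 0).
    by rewrite !mxE eqxx !mulr1n.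
  move/eqP; rewrite sqrf_eq1 => /orP[/eqP//|/eqP a1].
  by move: S00; rewrite -/a a1 oppr_ge0 ler10.
exists (row_mx 1%:M (2^-1 *: w)); split.
  by rewrite mul_row_col mulmx1 mulmx0 addr0.
rewrite {1}SE aa mul_col_row !mul0mx mul1mx scale_block_mx scalar_mx_block.
rewrite opp_block_mx add_block_mx !scaler0 !sub0r mul1mx scalerA divff ?pnatr_eq0//.
rewrite scale1r !oppr0 !addr0; congr block_mx.
by apply/matrixP => i j; rewrite !ord1 !mxE eqxx !mulr1n; ring.
Qed.

Lemma axis_head (v : 'rV[R]_(1 + m)) : axis (col_mx 1%:M 0) v = v 0 0.
Proof.
rewrite /axis -{1}[v]hsubmxK mul_row_col mulmx1 mulmx0 addr0 mxE.
by congr (v _ _); exact: val_inj.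
Qed.

End BoundaryLinearAlgebra.

Section BoundaryDirection.
Context {R : realType}.

Lemma strict_diff_ge0 m n (A : set 'rV[R]_m) (f : 'rV[R]_m -> 'rV[R]_n) x D v j :
  strict_diff A f x D -> A x -> f x 0 j = 0 ->
  (\forall t \near (0 : R)^'+, A (x + t *: v) /\ 0 <= f (x + t *: v) 0 j) ->
  0 <= (v *m D) 0 j.
Proof.
move=> sD Ax fx nA; apply/ler_addgt0Pr => e e0.
have v1 : 0 < `|v| + 1 by rewrite ltr_wpDl.
have [r r0 Hr] : exists2 r : R, 0 < r &
    lin_approx (A `&` [set a | `|a - x| < r]) f D (e / (`|v| + 1)).
  by apply: sD; rewrite divr_gt0.
have /filter_ex [t [t0 tr [At ft]]] : \forall t \near (0 : R)^'+,
    [/\ 0 < t, t < r / (`|v| + 1) & A (x + t *: v) /\ 0 <= f (x + t *: v) 0 j].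
  near=> t; split; near: t => //; first exact: nbhs_right_gt.
  by apply: nbhs_right_lt; rewrite divr_gt0.
have xtv : x + t *: v - x = t *: v by rewrite addrAC subrr add0r.
have ntv : `|t *: v| = t * `|v| by rewrite normrZ gtr0_norm.
have tv : t * `|v| <= t * (`|v| + 1) by rewrite ler_wpM2l ?lerDl// ltW.
have H : `|f (x + t *: v) - f x - (t *: v) *m D| <= e / (`|v| + 1) * (t * `|v|).
  have := Hr (x + t *: v) x; rewrite xtv ntv; apply; split=> //=.
    by rewrite xtv ntv (le_lt_trans tv)// -ltr_pdivlMr.
  by rewrite subrr normr0.
have := le_trans (norm_coord_le _ j) H.
rewrite -scalemxAl !mxE fx subr0 ler_norml => /andP[_].
rewrite -[\sum_(_ < _) _](_ : (v *m D) 0 j = _); last by rewrite mxE.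
move=> h1; rewrite -(pmulr_rge0 _ t0) mulrDr.
have h2 : e / (`|v| + 1) * (t * `|v|) <= t * e.
  rewrite mulrCA; apply: ler_wpM2l; first exact: ltW.
  by rewrite mulrAC ler_pdivrMr// ler_wpM2l ?lerDl// ltW.
by lra.
Unshelve. all: by end_near. Qed.

(** The coordinate 0 of f is nonnegative and vanishes at p: it has a minimum
there, and its derivative is 0. *)
Lemma boundary_column d (M : compact_mfd [set: 'rV[R]_d])
    (W : compact_mfd (@half_space R d)) (f : M -> W) i j p D : continuous f ->
  strict_tangent f i j p D -> chart_at j (f p) 0 0 = 0 -> forall k, D k 0 = 0.
Proof.
move=> cf [ip jp sD] fp0 k.
have [r r0 Hr] := local_dom_near cf ip jp.
have H (v : 'rV[R]_d) : 0 <= (v *m D) 0 0.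
  apply: (strict_diff_ge0 sD); [exact: local_dom_in|by rewrite local_exprE|].
  have v1 : 0 < `|v| + 1 by rewrite ltr_wpDl.
  near=> t.
  have t0 : 0 < t by near: t; exact: nbhs_right_gt.
  have tr : t < r / (`|v| + 1) by near: t; apply: nbhs_right_lt; rewrite divr_gt0.
  have At : local_dom f i j (chart_at i p + t *: v).
    apply: Hr => //; rewrite addrAC subrr add0r normrZ gtr0_norm//.
    apply: (@le_lt_trans _ _ (t * (`|v| + 1))); last by rewrite -ltr_pdivlMr.
    by rewrite ler_wpM2l ?lerDl// ltW.
  split=> //; have [q [iq jq] <-] := At; rewrite local_exprE//.
  exact: chart_in jq.
have := H 'e_k; have := H (- 'e_k); rewrite mulNmx -rowE !mxE oppr_ge0 => h1 h2.
by apply/eqP; rewrite eq_le h1.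
Unshelve. all: by end_near. Qed.

(** The derivative of the coordinate 0 of the involution in the inward direction
is nonnegative, as this coordinate is nonnegative and vanishes at p. *)
Lemma flip_inward d (W : C2_mfd (@half_space R d)) (j : chart_index W) p S :
  flip p = p -> strict_tangent (@flip _ _ _ W) j j p S ->
  chart_at j p 0 0 = 0 -> 0 <= S 0 0.
Proof.
move=> fp [jp jp' sS] p0.
have [r r0 Hr] := local_dom_flip_near fp jp.
have -> : S 0 0 = (('e_0 : 'rV[R]_d.+1) *m S) 0 0 by rewrite -rowE mxE.
apply: (strict_diff_ge0 sS); [exact: local_dom_in|by rewrite local_exprE// fp|].
have ne : `|'e_0 : 'rV[R]_d.+1| <= 1.
  apply: norm_row_le => // l; rewrite !mxE eqxx /=.
  by case: (_ == _); rewrite ?normr1 ?normr0.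
near=> t.
have t0 : 0 < t by near: t; exact: nbhs_right_gt.
have tr : t < r by near: t; exact: nbhs_right_lt.
have At : local_dom (@flip _ _ _ W) j j (chart_at j p + t *: 'e_0).
  apply: Hr; first by apply: corner_closed_half_space; [exact: chart_in|exact: ltW].
  rewrite addrAC subrr add0r normrZ gtr0_norm//; apply: le_lt_trans tr.
  by rewrite ler_piMr// ltW.
split=> //; have [q [iq jq] <-] := At; rewrite local_exprE//.
exact: chart_in jq.
Unshelve. all: by end_near. Qed.

End BoundaryDirection.

(** * The involution of P(C^2 + C^sigma) *)

Section DiagonalAction.
Context {R : realType} {n : nat}.
Local Notation C := (R[i]).
Variables (V : @C2_rep R n.+1) (eps : 'I_n.+1 -> R).
Hypothesis VE : rep_mx V = diag_mx (\row_j ((eps j)%:C)%C).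

(** The eigenvalues of the involution in the affine chart a, whose coordinates
are the quotients v_j / v_a. *)
Definition weight (a : 'I_n.+1) : 'rV[R]_n := \row_k (eps (lift a k) / eps a).

(** Row vectors list the real parts of the coordinates, then the imaginary parts;
the eigenvalues are real and appear once for each. *)
Lemma linear_local_diag a x :
  linear_local (rep_mx V) a a x = x *m diag_mx (row_mx (weight a) (weight a)).
Proof.
rewrite -[RHS]complexifyK /linear_local; congr realify; apply/rowP => k.
have E j : (homogeneous a (complexify x) *m rep_mx V) 0 j =
    homogeneous a (complexify x) 0 j * ((eps j)%:C)%C.
  by rewrite VE mul_mx_diag !mxE.
rewrite [LHS]mxE !E [homogeneous _ _ _ (lift _ _)]mxE liftK.
rewrite [homogeneous _ _ _ a]mxE unlift_none mul1r [complexify x 0 k]mxE.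
have F j (d : 'rV[R]_(n + n)) : (x *m diag_mx d) 0 j = x 0 j * d 0 j.
  by rewrite mul_mx_diag mxE.
rewrite [RHS]mxE !F row_mxEl row_mxEr [weight a 0 k]mxE.
rewrite -mulrA -fmorphV -rmorphM /=.
by apply/eqP; rewrite eq_complex /=; rewrite !mulr0 subr0 add0r !eqxx.
Qed.

Lemma strict_tangent_diag (a : chart_index (projectivization V)) (L : projectivization V) :
  affine_dom a L -> flip L = L ->
  strict_tangent (@flip _ _ _ (projectivization V)) a a L
    (diag_mx (row_mx (weight a) (weight a))).
Proof.
move=> aL fL; split=> //; first by rewrite fL.
move=> e e0; exists 1 => // x y [[p [ap fp] <-] _] [[q [aq fq] <-] _].
have E r : affine_dom a r ->
    local_expr (@flip _ _ _ (projectivization V)) a a (affine_coord a r) =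
    affine_coord a r *m diag_mx (row_mx (weight a) (weight a)).
  by move=> ar; rewrite -linear_local_diag -linear_act_local ?rep_mx_unit//.
rewrite !E// -mulmxBl subrr normr0; apply: mulr_ge0 => //; exact: ltW.
Qed.

End DiagonalAction.

Section ReflectedPlane.
Context {R : realType}.
Local Notation C := (R[i]).

Definition reflection_rep : C2_rep 3 := sum_rep (trivial_rep R 2) (sign_rep R).
Local Notation N := (projectivization reflection_rep).

Definition reflection_sign (j : 'I_3) : R := if (j < 2)%N then 1 else -1.

Lemma reflection_repE :
  rep_mx reflection_rep = diag_mx (\row_j ((reflection_sign j)%:C)%C).
Proof.
apply/matrixP => i j; rewrite [RHS]mxE [X in _ = X *+ _]mxE /rep_mx /=.
case: (@split_ordP 2 1 i) => k ->; case: (@split_ordP 2 1 j) => l ->.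
- rewrite (block_mxEul _ _ _ _ k l) mxE /reflection_sign /= ltn_ord -!val_eqE.
  by [].
- rewrite [LHS]block_mxEur mxE -val_eqE /=.
  by rewrite ltn_eqF// ltn_addr.
- rewrite [LHS]block_mxEdl mxE -val_eqE /=.
  by rewrite gtn_eqF// ltn_addr.
- rewrite [LHS]block_mxEdr !mxE /reflection_sign /= !ord1.
  by rewrite ?eqxx ?mulr1n rmorphN rmorph1.
Qed.

Lemma diag_weight_trace n (w : 'rV[R]_n) :
  \tr (diag_mx (row_mx w w)) = 2 * \sum_k w 0 k.
Proof.
rewrite mxtrace_diag big_split_ord /= mulr_natl mulr2n.
by congr (_ + _); apply: eq_bigr => k _; rewrite ?row_mxEl ?row_mxEr.
Qed.

(** One of the two eigenvalues is 1 and the other is -1: in these charts the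
fixed points form the projective line P(C^2). *)
Lemma weight_line (a : 'I_3) : (a < 2)%N -> \sum_k weight reflection_sign a 0 k = 0.
Proof.
move=> a2; rewrite !big_ord_recl big_ord0 !mxE /reflection_sign /=.
case: a a2 => [[|[|//]] i] _ /=; rewrite ?divr1; lra.
Qed.

Lemma weight_point : diag_mx (row_mx (weight reflection_sign (2 : 'I_3))
  (weight reflection_sign (2 : 'I_3))) = - 1%:M :> 'M[R]_(2 + 2).
Proof.
suff -> : weight reflection_sign (2 : 'I_3) = const_mx (-1).
  by rewrite row_mx_const; apply/matrixP => i j; rewrite !mxE mulNrn.
apply/rowP => k; rewrite !mxE /reflection_sign /=.
by case: k => [[|[|//]] i] /=; rewrite invrN invr1 mulrN1.
Qed.

Definition isolated_point : N := line_through ('e_2 : 'rV[C]_3).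

Lemma basis_neq0 n (k : 'I_n) : ('e_k : 'rV[C]_n) != 0.
Proof.
apply/eqP => /(congr1 (fun v : 'rV_n => v 0 k)) /eqP.
by rewrite !mxE !eqxx oner_eq0.
Qed.

Lemma isolated_point_fixed : flip isolated_point = isolated_point.
Proof.
rewrite /flip /= /proj_flip linear_act_through ?basis_neq0 ?rep_mx_unit//.
rewrite reflection_repE mul_mx_diag.
have -> : (\matrix_(i, j) (('e_2 : 'rV[C]_3) i j * (\row_j ((reflection_sign j)%:C)%C) 0 j))
   = (-1) *: 'e_2.
  apply/rowP => j; rewrite !mxE; have [->|_] := eqVneq j 2; last by rewrite mul0r mulr0.
  by rewrite mul1r mulr1 /reflection_sign /= rmorphN rmorph1.
by rewrite line_throughZ ?oppr_eq0 ?oner_eq0 ?basis_neq0.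
Qed.

Lemma isolated_point_chart : affine_dom 2 isolated_point.
Proof. by rewrite affine_dom_through ?basis_neq0// mxE !eqxx oner_neq0. Qed.

Lemma not_isolated (L : N) : L != isolated_point ->
  exists2 a : 'I_3, (a < 2)%N & affine_dom a L.
Proof.
move=> Ly; apply: contrapT => nL; move: Ly; apply/negP; rewrite negbK; apply/eqP.
have L0 (a : 'I_3) : (a < 2)%N -> gen L 0 a = 0.
  by move=> a2; apply: contrapT => /eqP La; apply: nL; exists a.
have E : gen L = gen L 0 2 *: 'e_2.
  apply/rowP => j; rewrite !mxE eqxx /=; have [->|j2] := eqVneq j 2.
    by rewrite mulr1.
  rewrite mulr0 L0//; case: j j2 => [[|[|[|//]]] i] //= H.
rewrite -[L]line_through_gen E line_throughZ ?basis_neq0//.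
by apply: contraNneq (gen_neq0 L) => c0; rewrite E c0 scale0r.
Qed.

End ReflectedPlane.

(** * The two planes are not cobordant *)

Section FixedCurveArcs.
Context {R : realType} {d : nat} (W : C2_mfd (@half_space R d)).
Local Notation inv := (@flip R d.+1 _ W).

Lemma interior_arc p : fixed_curve_set W p -> ~ boundary p ->
  exists (U : set W) (g : R -> W) (h : W -> R),
    [/\ parametrizes (fixed_curve_set W) `]-1, 1[ U g h, U p & h p = 0].
Proof.
move=> Fp bp; have fp := Fp.1; have HH := @corner_closed_half_space R d.
have [i ip] := mfd_cover p; have [S sS] := flip_tangent_ex fp ip.
have trS := (fixed_curve_setP HH fp sS).1 Fp.
have [l [e [el SE]]] := involution_line (flip_tangent_sqr HH fp sS) trS.
have p0 : 0 < chart_at i p 0 0.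
  rewrite lt0r; apply/andP; split; last exact: (chart_in ip).
  by apply/eqP => p0; apply: bp; exists i.
rewrite SE in sS.
apply: (fixed_arc HH (S := setT) Fp el sS p0) => [x xp|a t a0].
  split=> // _; rewrite /half_space /=.
  have := le_lt_trans (norm_coord_le _ 0) xp; rewrite !mxE ltr_norml => /andP[? _].
  by apply: ltW; lra.
by rewrite /= in_itv /= -ltr_norml; split=> [->|[]].
Qed.

(** The hyperplane of the vectors with coordinate 0 equal to 0 is tangent to the
boundary, so that the points of W near p are those with nonnegative [axis l]. *)
Lemma boundary_arc i p (l : 'cV[R]_d.+1) (e : 'rV[R]_d.+1) :
  fixed_curve_set W p -> e *m l = 1%:M ->
  strict_tangent inv i i p (2 *: (l *m e) - 1%:M) ->
  (forall v : 'rV[R]_d.+1, axis l v = v 0 0) -> chart_at i p 0 0 = 0 ->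
  exists (U : set W) (g : R -> W) (h : W -> R),
    [/\ parametrizes (fixed_curve_set W) `[0, 1[ U g h, U p & h p = 0].
Proof.
move=> Fp el sS lE p0; have HH := @corner_closed_half_space R d.
apply: (fixed_arc HH (S := [set t | 0 <= t]) Fp el sS ltr01) => [x _|a t a0].
  by rewrite lE /half_space /= !mxE p0 subr0.
rewrite /= in_itv /= pmulr_rge0//; split=> [/andP[t0 t1]|[t1 t0]].
  by rewrite ger0_norm.
by move: t1; rewrite ger0_norm// t0.
Qed.

End FixedCurveArcs.

Theorem corollary9p8 (R : realType) :
  ~ cobordant
      (projectivization (trivial_rep R 3))
      (projectivization (sum_rep (trivial_rep R 2) (sign_rep R))).
Proof.
move=> [W [k [JW [iM [iN [_ [embM embN _ cover] eqM eqN _]]]]]].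
have HH := @corner_closed_half_space R (2 + 2).
have HM := @corner_closedT R (2 + 2).
have [injM smM freeM] := embM; have [injN smN freeN] := embN.
have boundaryP (w : W) : boundary w -> exists i, dom (chart_at i) w /\ chart_at i w 0 0 = 0.
  by move=> [i iw w0]; exists i.
have tangentN (a : 'I_3) (L : projectivization (reflection_rep (R := R)))
    (i : chart_index W) : flip L = L -> affine_dom a L ->
    dom (chart_at i) (iN L) -> exists (B : 'M[R]_(2 + 2)) D S,
    [/\ B = diag_mx (row_mx (weight reflection_sign a) (weight reflection_sign a)),
      strict_tangent iN a i L D, strict_tangent (@flip _ _ _ W) i i (iN L) S,
      row_free D & B *m D = D *m S].
  move=> fL aL iL; have fL' : flip (iN L) = iN L by rewrite -eqN fL.
  have [D sD] := @strict_tangent_ex _ _ _ _ _ _ _ iN a i L smN aL iL.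
  have [S sS] := flip_tangent_ex fL' iL.
  have sB := strict_tangent_diag reflection_repE aL fL.
  exists (diag_mx (row_mx (weight reflection_sign a) (weight reflection_sign a))), D, S.
  split=> //; first exact: freeN (strict_tangent_map sD).
  exact: (equivariant_strict_tangent HM smN.1 eqN fL sD sB sS).
(* trace 4 on the boundary, hence 3 or 5 in W, where X requires 2 - 5 *)
have notM (L : projectivization (trivial_rep R 3)) : ~ fixed_curve_set W (iM L).
  move=> FL; have fL := FL.1; have [i iL] := mfd_cover (iM L).
  have [a aL] := mfd_cover L; have [D sD] := strict_tangent_ex smM aL iL.
  have [S sS] := flip_tangent_ex fL iL.
  have flipM : @flip _ _ _ (projectivization (trivial_rep R 3)) = id.
    exact: linear_act1.
  have sB : strict_tangent (@flip _ _ _ (projectivization (trivial_rep R 3))) a a L 1%:M.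
    by rewrite flipM; exact: strict_tangent_id.
  have BD : 1%:M *m D = D *m S.
    by apply: (equivariant_strict_tangent HM smM.1 eqM _ sD sB sS); rewrite flipM.
  have [c cc trS] := extension_trace (freeM _ _ _ _ (strict_tangent_map sD)) BD
    (flip_tangent_sqr HH fL sS).
  have := (fixed_curve_setP HH fL sS).1 FL; rewrite trS mxtrace1.
  move/eqP: cc; rewrite sqrf_eq1 => /orP[]/eqP ->; lra.
(* away from the isolated point: trace 0 on the boundary, hence 1 or -1 in W *)
have onlyN (L : projectivization (reflection_rep (R := R))) :
    fixed_curve_set W (iN L) -> L = isolated_point.
  move=> FL; have fL' := FL.1; apply/eqP; apply: contrapT => /negP Ly.
  have fL : flip L = L by apply: injN; rewrite eqN.
  have [a a2 aL] := not_isolated Ly; have [i iL] := mfd_cover (iN L).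
  have [B [D [S [BE sD sS Dfree BD]]]] := tangentN a L i fL aL iL.
  have [c cc trS] := extension_trace Dfree BD (flip_tangent_sqr HH fL' sS).
  have := (fixed_curve_setP HH fL' sS).1 FL.
  rewrite trS BE diag_weight_trace weight_line// mulr0.
  move/eqP: cc; rewrite sqrf_eq1 => /orP[]/eqP ->; lra.
pose y : projectivization (reflection_rep (R := R)) := isolated_point.
have fy : flip (iN y) = iN y by rewrite -eqN isolated_point_fixed.
have bdy : boundary (iN y) by rewrite -cover; right; exists y.
have [j [jy y0]] := boundaryP _ bdy.
have [B [D [S [BE sD sS Dfree BD]]]] :=
  tangentN 2 y j isolated_point_fixed isolated_point_chart jy.
rewrite BE weight_point in BD.
have [e [el SE]] := inward_line Dfree (boundary_column smN.1 sD y0) BD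
  (flip_tangent_sqr HH fy sS) (flip_inward fy sS y0).
have Fy : fixed_curve_set W (iN y).
  apply: (fixed_curve_setP HH fy sS).2; rewrite SE linearB linearZ /= mxtrace_mulC.
  by rewrite el !mxtrace1 mulr1.
rewrite SE in sS.
have [U0 [g0 [h0 [P0 Uy hy]]]] := boundary_arc Fy el sS (@axis_head R (2 + 2)) y0.
have g0y : g0 0 = iN y by rewrite -hy (par_coordK P0).
apply: (@single_end_absurd R W (fixed_curve_set W) U0 g0 h0).
- exact: mfd_hausdorff.
- exact: fixed_curve_set_compact.
- exact: P0.
rewrite g0y => x Fx xy; apply: interior_arc => //.
rewrite -cover => -[[L _ Lx]|[L _ Lx]]; first by apply: (notM L); rewrite Lx.
by apply: xy; rewrite -Lx (onlyN L)// Lx.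
Qed.
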